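(* Let $\omega>0$, $\sigma>0$, $\rho>0$, $\lambda>0$, let $z\in\mathcal{B}_\omega$ and $f_\sigma=\phi_\sigma*z$. Let $F_3(u)=\int_{\mathbb{R}}|u'|+\lambda\|\phi_\rho*u-f_\sigma\|_{L^2(\mathbb{R})}^2$. The following hold. (1) Let $\phi_\sigma,\phi_\rho\in\mathcal{K}$ (with parameters $\sigma$ and $\rho$ respectively). Then $u\equiv0$ is the unique minimiser of $F_3$ over $BV(\mathbb{R})$ if and only if $\|\phi_\rho*f_\sigma\|_*\le\frac1{2\lambda}$. (2) Let $\phi_\sigma=\hat\phi_\sigma$, $\phi_\rho=\hat\phi_\rho$, and $z\in\mathcal{B}_\omega^{ij}$ for some $i,j\in\{0,1\}$. Let $\sigma\le\rho\le\frac\omega2$. If $$\frac2\lambda+\frac1{15\rho^2}\left(-\sigma^3+5\rho\sigma^2+17\rho^3\right)<\omega,$$ then $u=z$ is the unique minimiser of $F_3$ over $\mathcal{B}^{ij}$.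
   Context: Functions are identified when equal almost everywhere, and $\int_{\mathbb{R}}|u'|$ denotes the total variation of $u$ on $\mathbb{R}$. Bar codes: $\mathcal{B}=\{u\in BV(\mathbb{R};\{0,1\}): u=0 \text{ a.e. in } \mathbb{R}\setminus[0,1]\}$. Up to null sets, for $u\in\mathcal{B}$ the set $\{x\in[0,1]:u(x)=1\}$ is a finite disjoint union of non-empty (nondegenerate) intervals $b_i$ (bars), and $\{x\in[0,1]:u(x)=0\}$ is a finite disjoint union of non-empty intervals $w_i$ (white spaces). For $\omega>0$, $\mathcal{B}_\omega$ is the set of $u\in\mathcal{B}$ all of whose bars and white spaces satisfy $|b_i|\ge\omega$, $|w_i|\ge\omega$. For $i,j\in\{0,1\}$, $\mathcal{B}^{ij}$ (resp. $\mathcal{B}_\omega^{ij}$) is the set of $u\in\mathcal{B}$ (resp. $u\in\mathcal{B}_\omega$) for which there exist $x_1\in(0,1]$ and $x_2\in[0,1)$ with $u=i$ on $[0,x_1]$ and $u=j$ on $[x_2,1]$; i.e. $u$ starts with a bar if $i=1$ and with a space if $i=0$, and ends with a bar if $j=1$ and with a space if $j=0$. Kernels: $\mathcal{K}$ is the class of $\phi_\sigma\in L^1(\mathbb{R})$, with parameter $\sigma>0$ (the subscript), of the form $\phi_\sigma(x)=p(-x,\sigma)\chi_{[-\sigma,0]}(x)+p(x,\sigma)\chi_{[0,\sigma]}(x)$, where $p(\cdot,\sigma)$ is non-negative and monotonically decreasing on $[0,\sigma]$ with $\int_0^\sigma p(x,\sigma)\,dx=\frac12$; $\phi_\rho$ denotes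 the kernel of the same type with parameter $\rho$. The hat function is $\hat\phi_\sigma(x)=\frac1\sigma\left(1-\frac{|x|}{\sigma}\right)$ for $|x|<\sigma$ and $\hat\phi_\sigma(x)=0$ for $|x|\ge\sigma$. Dual norm: $\|f\|_*=\sup\left\{\left|\int_{\mathbb{R}}fv\right| : v\in L^1(\mathbb{R}),\ \int_{\mathbb{R}}|v'|\le 1\right\}$. *)

(* Defs.v *)
(* Functions on the line are plain functions R -> R; since they are meant up to
   null sets, conditions on bar codes and kernels are imposed almost everywhere. *)
From HB Require Import structures.
From mathcomp Require Import all_boot all_order all_algebra.
From mathcomp Require Import all_classical all_reals all_analysis.

Set Implicit Arguments.
Unset Strict Implicit.
Unset Printing Implicit Defensive.
Import Order.TTheory GRing.Theory Num.Theory.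
Import numFieldNormedType.Exports.

Local Open Scope classical_set_scope.
Local Open Scope ring_scope.

Notation leb R := (@lebesgue_measure R).

Section functions.
Context {R : realType}.
Implicit Types (f g u v phi : R -> R).

Definition L1 : set (R -> R) :=
  [set u | (leb R).-integrable setT (EFin \o u)].

Definition convol f g : R -> R :=
  fun x => (\int[leb R]_y (f (x - y) * g y))%R.

Definition tv_test : set (R -> R) :=
  [set phi | [/\ forall x : R, derivable phi x 1, continuous (derive1 phi),
                 compact (closure [set x : R | phi x != 0])
               & forall x, `|phi x| <= 1]].

(* The distributional total variation, written \int |u'| ; it only depends on
   the class of u modulo a.e. equality, unlike the pointwise variation
   total_variation of realfun. *)
Definition tv u : \bar R :=
  ereal_sup [set (\int[leb R]_x (u x * derive1 phi x)%:E)%E | phi in tv_test].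

Definition BVR : set (R -> R) := [set u | L1 u /\ (tv u < +oo)%E].

Definition dual_norm f : \bar R :=
  ereal_sup [set `| \int[leb R]_x (f x * v x)%:E |%E
            | v in [set v | L1 v /\ (tv v <= 1)%E]].

Definition barcode : set (R -> R) :=
  [set u | [/\ BVR u,
               \forall x \ae leb R, u x = 0 \/ u x = 1
             & u = cst 0 %[ae leb R in ~` `[0, 1]]]].

(* ]a, b[ is, up to its endpoints, one of the bars (c = true) or white spaces
   (c = false) of u, i.e. a connected component of {x in [0, 1] | u x = c}
   up to null sets *)
Definition is_stripe u (c : bool) (a b : R) : Prop :=
  [/\ 0 <= a, a < b, b <= 1,
      u = cst c%:R %[ae leb R in `]a, b[%classic]
    & forall a' b', 0 <= a' -> a' <= a -> b <= b' -> b' <= 1 ->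
        u = cst c%:R %[ae leb R in `]a', b'[%classic] -> a' = a /\ b' = b].

Definition barcode_min (omega : R) : set (R -> R) :=
  [set u | barcode u /\
           forall (c : bool) (a b : R), is_stripe u c a b -> omega <= b - a].

Definition start_end (i j : bool) : set (R -> R) :=
  [set u | exists x1 x2 : R,
     [/\ 0 < x1 <= 1, 0 <= x2 < 1,
         u = cst i%:R %[ae leb R in `[0, x1]%classic]
       & u = cst j%:R %[ae leb R in `[x2, 1]%classic]]].

(* L1 phi is not redundant: phi is only a.e. equal to the formula, and L1
   includes Borel measurability. *)
Definition kernel_class (sigma : R) : set (R -> R) :=
  [set phi | L1 phi /\
    exists p : R -> R,
      [/\ forall x, x \in `[0, sigma] -> 0 <= p x,
          {in `[0, sigma] &, forall x y, x <= y -> p y <= p x},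
          (\int[leb R]_(x in `[0%R, sigma]) (p x)%:E = (2^-1)%:E)%E
        & phi = (fun x => p (- x) * \1_(`[- sigma, 0]) x
                          + p x * \1_(`[0, sigma]) x) %[ae leb R]]].

Definition hat (sigma : R) : R -> R :=
  fun x => if `|x| < sigma then sigma^-1 * (1 - `|x| / sigma) else 0.

Definition F3 (lambda : R) phi_rho f u : \bar R :=
  (tv u + lambda%:E *
     'N[leb R]_2%:E [EFin \o (fun x => (convol phi_rho u x - f x)%R)] ^+ 2)%E.

Definition is_minimiser (F : (R -> R) -> \bar R) (X : set (R -> R)) u : Prop :=
  X u /\ forall v, X v -> (F u <= F v)%E.

Definition is_unique_minimiser (F : (R -> R) -> \bar R) (X : set (R -> R)) u :=
  is_minimiser F X u /\
  forall v, is_minimiser F X v -> v = u %[ae leb R].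

End functions.

(* Main.v *)
(* For (1), phi_rho is even up to null sets, so that expanding the square gives
   F3 u = tv u - 2 lambda \int u (phi_rho * f) + lambda ||phi_rho * u||^2 + F3 0.
   Comparing the linear term with the total variation along the rays t u gives
   the equivalence; uniqueness only uses that tv u = 0 forces u = 0 in L1.

   For (2), write z as an alternating sum of Heaviside functions with jumps at
   distance at least omega >= 2 rho, and put w = u - z, D = (phi_rho - phi_sigma) * z.
   Since phi_rho * D is <= 0 on the bars of z and >= 0 on its white spaces, w and
   phi_rho * D have the same sign and
     ||phi_rho * u - f||^2 >= ||phi_rho * z - f||^2 + ||phi_rho * w||^2.
   If u coincides with 1 - z on m of the inner stripes of z (u "misses" them), then
   u has at least n - 2m jumps, n being the number of jumps of z. On a missed stripe
   |w| = 1, so it contributes at least omega - 14 rho / 15 to ||phi_rho * w||^2,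
   which the hypothesis makes larger than 2 / lambda. When no stripe is missed,
   equality forces phi_rho * w = 0, and then w = 0 stripe by stripe, because w has
   constant sign on each stripe. *)

(* The edges of [z] are not given: [tv] is defined by duality and does not see null sets. Both the
   edges and the lower bounds on [tv u] therefore come from increments at Lebesgue points, obtained
   by testing with smoothed steps of width [h] and letting [h] tend to 0. The hat has an explicit
   primitive [S], so [hat * z] is an alternating sum of translates of [S], and [D] is an alternating
   sum of translates of the single odd profile [S_rho - S_sigma], supported in [[- rho, rho]]. The
   condition [sigma <= rho] fixes the sign of this profile on each half line, and [2 * rho <= omega]
   keeps the effects of non-adjacent edges apart. Bar codes do not form a convex set, but a
   competitor with values 0 and 1 can only differ from [z] in one direction on each stripe. This
   known sign of [w] makes the cross term of the quadratic expansion nonnegative, and it lets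
   uniqueness be proved with nonnegative test functions instead of a deconvolution. *)
Require Import Defs.
From HB Require Import structures.
From mathcomp Require Import all_boot all_order all_algebra.
From mathcomp Require Import all_classical all_reals all_analysis.
From mathcomp Require Import measurable_realfun lra.

Set Implicit Arguments.
Unset Strict Implicit.
Unset Printing Implicit Defensive.
Import Order.TTheory GRing.Theory Num.Theory.
Import numFieldNormedType.Exports.

Local Open Scope classical_set_scope.
Local Open Scope ring_scope.

(** * Reflection invariance and bounded integrable functions *)

Section reflection.
Context {R : realType}.
Local Notation mu := (@lebesgue_measure R).
Implicit Types (c : R).

Let reflect c : measurableTypeR R -> measurableTypeR R := fun x => c - x.

Let measurable_reflect c : measurable_fun setT (reflect c).
Proof. exact: (@measurable_funB _ _ _ _ (cst c) id). Qed.

Let lebesgue_reflect c : {measure set (measurableTypeR R) -> \bar R} :=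
  measure_function_pushforward__canonical__measure_function_Measure
    (lebesgue_measure : {measure set (measurableTypeR R) -> \bar R})
    (measurable_reflect c).

(** By uniqueness of the Lebesgue measure it suffices to treat the intervals []a, b]]; reflection
    turns them into intervals closed at the other end, of the same length. *)
Lemma lebesgue_measure_reflect c (A : set R) : measurable A ->
  mu ((fun x : R => c - x) @^-1` A) = mu A.
Proof.
move=> mA; apply/esym; rewrite (@lebesgue_measure_unique R (lebesgue_reflect c))//.
move=> _ [[a b] _ <-]; rewrite /= /pushforward/=.
rewrite [X in _ = lebesgue_measure X](_ : _ = `[c - b, c - a[%classic).
  rewrite !lebesgue_measure_itv/= !lte_fin ltrD2l ltrN2 -!EFinD.
  by case: ifPn => // _; congr (_%:E); lra.
by apply/seteqP; split => x /=; rewrite /reflect !in_itv/= => /andP[? ?];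
  apply/andP; split; lra.
Qed.

Lemma integral_reflect c (f : R -> \bar R) : measurable_fun setT f ->
  (\int[mu]_x f (c - x)%R = \int[mu]_x f x)%E.
Proof.
suff H (g : R -> \bar R) : measurable_fun setT g -> (forall x, 0 <= g x)%E ->
    (\int[mu]_x g (c - x)%R = \int[mu]_x g x)%E.
  move=> mf; rewrite integralE [RHS]integralE; congr (_ - _)%E.
    rewrite -[RHS]H; [|exact: measurable_funepos|by []].
    by apply: eq_integral => x _; rewrite !funeposE.
  rewrite -[RHS]H; [|exact: measurable_funeneg|by []].
  by apply: eq_integral => x _; rewrite !funenegE.
move=> mg g0.
rewrite [RHS](eq_measure_integral (lebesgue_reflect c)); last first.
  by move=> A mA _; rewrite /= /pushforward lebesgue_measure_reflect.
by rewrite [RHS](ge0_integral_pushforward (measurable_reflect c)).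
Qed.

Lemma measurable_fun_reflect c d (T : measurableType d) (f : R -> T) :
  measurable_fun setT f -> measurable_fun setT (fun x : R => f (c - x)).
Proof. by move=> mf; exact: (measurableT_comp mf (measurable_reflect c)). Qed.

Lemma integrable_reflect c (f : R -> \bar R) : mu.-integrable setT f ->
  mu.-integrable setT (fun x : R => f (c - x)).
Proof.
move=> /integrableP[mf foo]; apply/integrableP; split.
  exact: measurable_fun_reflect.
rewrite (integral_reflect c (f := abse \o f))//; exact: measurableT_comp.
Qed.

Lemma Rintegral_reflect c (f : R -> R) : measurable_fun setT f ->
  \int[mu]_x f (c - x) = \int[mu]_x f x.
Proof.
move=> mf; congr fine; apply: (integral_reflect c (f := EFin \o f)).
exact/measurable_EFinP.
Qed.

Lemma aeS (P Q : R -> Prop) : (forall x, P x -> Q x) ->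
  (\forall x \ae mu, P x) -> \forall x \ae mu, Q x.
Proof. by move=> PQ [A [mA A0 PA]]; exists A; split => // x /= nQ; apply: PA => /PQ. Qed.

Lemma aeS2 (P Q S : R -> Prop) : (forall x, P x -> Q x -> S x) ->
  (\forall x \ae mu, P x) -> (\forall x \ae mu, Q x) -> \forall x \ae mu, S x.
Proof.
have F : Filter (almost_everywhere mu) by exact: _.
move=> PQS hP hQ; apply: (@aeS (fun x => P x /\ Q x)) => [x []|]; first exact: PQS.
exact: (@filterI _ _ F).
Qed.

Lemma ae_reflect c (P : R -> Prop) :
  (\forall x \ae mu, P x) -> \forall x \ae mu, P (c - x).
Proof.
move=> [A [mA A0 PA]]; exists ((fun x => c - x) @^-1` A); split.
- by rewrite -[X in measurable X]setTI; exact: measurable_reflect.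
- by rewrite -A0; exact: lebesgue_measure_reflect.
- by move=> x Px; exact: PA.
Qed.

End reflection.

Section bounded_integrable.
Context {R : realType}.
Local Notation mu := (@lebesgue_measure R).
Implicit Types (f g u v : R -> R).

(** The multipliers of [L1]. The bound is pointwise rather than essential, so that products and
    reflections involve no null sets. *)
Definition bdd_measurable f :=
  measurable_fun setT f /\ exists M : R, forall x, `|f x| <= M.

Lemma L1_measurable u : L1 u -> measurable_fun setT u.
Proof. by move=> /integrableP[/measurable_EFinP]. Qed.

Lemma L1D u v : L1 u -> L1 v -> L1 (fun x => u x + v x).
Proof. by move=> hu hv; exact: (integrableD measurableT hu hv). Qed.

Lemma L1B u v : L1 u -> L1 v -> L1 (fun x => u x - v x).
Proof. by move=> hu hv; exact: (integrableB measurableT hu hv). Qed.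

Lemma L1Z k u : L1 u -> L1 (fun x => k * u x).
Proof. by move=> hu; exact: (integrableZl measurableT k hu). Qed.

Lemma L1_reflect c u : L1 u -> L1 (fun x => u (c - x)).
Proof. exact: (@integrable_reflect _ _ (EFin \o u)). Qed.

Lemma L1_abs u : L1 u -> L1 (fun x => `|u x|).
Proof. exact: integrable_norm. Qed.

Lemma L1_le u v : measurable_fun setT u -> (forall x, `|u x| <= `|v x|) ->
  L1 v -> L1 u.
Proof.
move=> mu_ uv; apply: le_integrable => //; first exact/measurable_EFinP.
by move=> x _; rewrite /= lee_fin.
Qed.

(** Measurability of [v] is assumed because it means Borel measurability, which a change on a null
    set can destroy. *)
Lemma L1_ae u v : measurable_fun setT v -> u = v %[ae mu] -> L1 u -> L1 v.
Proof.
move=> mv uv hu; apply/integrableP; split; first exact/measurable_EFinP.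
case/integrableP : hu => mu_; apply: le_lt_trans.
rewrite le_eqVlt; apply/orP; left; apply/eqP; apply: ge0_ae_eq_integral => //.
- by apply: measurableT_comp => //; exact/measurable_EFinP.
- exact: measurableT_comp.
- by apply: aeS uv => x /(_ I) /= ->.
Qed.

Lemma L1_mul f u : bdd_measurable f -> L1 u -> L1 (fun x => f x * u x).
Proof.
move=> [mf [M fM]] hu; have M0 : 0 <= M by apply: le_trans (fM 0).
apply: (@L1_le _ (fun x => M * u x)); last exact: L1Z.
  by apply: measurable_funM => //; exact: L1_measurable.
by move=> x; rewrite !normrM ler_wpM2r// (le_trans (fM x))// ger0_norm.
Qed.

Lemma bdd_measurableD f g : bdd_measurable f -> bdd_measurable g ->
  bdd_measurable (fun x => f x + g x).
Proof.
move=> [mf [M fM]] [mg [N gN]]; split; first exact: measurable_funD.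
by exists (M + N) => x; rewrite (le_trans (ler_normD _ _))// lerD.
Qed.

Lemma bdd_measurableN f : bdd_measurable f -> bdd_measurable (fun x => - f x).
Proof.
move=> [mf [M fM]]; split; first exact: measurable_funN.
by exists M => x; rewrite normrN.
Qed.

Lemma bdd_measurableB f g : bdd_measurable f -> bdd_measurable g ->
  bdd_measurable (fun x => f x - g x).
Proof. by move=> hf /bdd_measurableN; exact: bdd_measurableD. Qed.

Lemma bdd_measurable_cst k : bdd_measurable (fun=> k).
Proof. by split => //; exists `|k|. Qed.

Lemma bdd_measurable_reflect c f : bdd_measurable f ->
  bdd_measurable (fun x => f (c - x)).
Proof.
by move=> [mf [M fM]]; split; [exact: measurable_fun_reflect|exists M].
Qed.

Lemma ae_eq_Rintegral f g : measurable_fun setT f -> measurable_fun setT g ->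
  f = g %[ae mu] -> \int[mu]_x f x = \int[mu]_x g x.
Proof.
move=> mf mg fg; congr fine; apply: ae_eq_integral => //.
- exact/measurable_EFinP.
- exact/measurable_EFinP.
- by apply: aeS fg => x /(_ I) /= ->.
Qed.

Lemma L1_EFin_Rintegral u : L1 u ->
  (\int[mu]_x (u x)%:E = (\int[mu]_x u x)%:E)%E.
Proof. by move=> hu; rewrite /Rintegral fineK//; exact: integrable_fin_num hu. Qed.

Lemma Rintegral_ge0_eq0 f : L1 f -> (\forall x \ae mu, 0 <= f x) ->
  \int[mu]_x f x <= 0 -> \forall x \ae mu, f x = 0.
Proof.
move=> hf f0 If.
have mf := L1_measurable hf.
have fE : f = (fun x => `|f x|) %[ae mu].
  by apply: aeS f0 => x fx _; rewrite ger0_norm.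
have /ae_eq_integral_abs : (\int[mu]_x `|(f x)%:E| = 0)%E.
  have -> : (\int[mu]_x `|(f x)%:E| = (\int[mu]_x `|f x|)%:E)%E.
    by rewrite -L1_EFin_Rintegral//; exact: L1_abs.
  rewrite -(ae_eq_Rintegral _ _ fE)//; last exact: measurableT_comp.
  apply/eqP; rewrite eqe eq_le If/= (ae_eq_Rintegral _ _ fE)//; last first.
    exact: measurableT_comp.
  exact: Rintegral_ge0.
move=> /(_ measurableT ((measurable_EFinP _ _).2 mf)).
by apply: aeS => x /(_ I)[].
Qed.

Lemma ae_le_Rintegral f g : L1 f -> L1 g -> (\forall x \ae mu, f x <= g x) ->
  \int[mu]_x f x <= \int[mu]_x g x.
Proof.
move=> hf hg fg; rewrite -subr_ge0 -RintegralB//.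
rewrite (@ae_eq_Rintegral _ (fun x => `|g x - f x|)).
- exact: Rintegral_ge0.
- by apply: measurable_funB; exact: L1_measurable.
- by apply: measurableT_comp => //; apply: measurable_funB; exact: L1_measurable.
- by apply: aeS fg => x xfg _; rewrite ger0_norm// subr_ge0.
Qed.

End bounded_integrable.

(** * Convolution *)

Section convolution.
Context {R : realType}.
Local Notation mu := (@lebesgue_measure R).
Implicit Types (phi f u v : R -> R).

Lemma convol_integrand phi u x : bdd_measurable phi -> L1 u ->
  L1 (fun y => phi (x - y) * u y).
Proof. by move=> bphi hu; apply: L1_mul => //; exact: bdd_measurable_reflect. Qed.

Lemma convol_integrandC phi u x : L1 phi -> bdd_measurable u ->
  L1 (fun y => phi (x - y) * u y).
Proof.
move=> hphi bu; rewrite (_ : (fun _ => _) = fun y => u y * phi (x - y)).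
  by apply: L1_mul => //; exact: L1_reflect.
by apply/funext => y; rewrite mulrC.
Qed.

(** Evenness makes convolution with [phi] self-adjoint; boundedness makes the convolution with an
    [L1] function an absolutely convergent integral at every point. *)
Definition even_kernel phi :=
  [/\ L1 phi, bdd_measurable phi & forall x, phi (- x) = phi x].

Let T := measurableTypeR R.

Let measurable_integrand phi u f : measurable_fun setT phi ->
  measurable_fun setT u -> measurable_fun setT f ->
  measurable_fun setT (fun p : T * T => (phi (p.1 - p.2) * u p.2 * f p.1)%:E).
Proof.
move=> mphi mu_ mf; apply/measurable_EFinP; apply: measurable_funM.
  apply: measurable_funM.
    apply: (measurableT_comp (f := (phi : T -> T))) => //.
    by apply: measurable_funB; [exact: measurable_fst|exact: measurable_snd].
  by apply: (measurableT_comp (f := (u : T -> T))) => //; exact: measurable_snd.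
by apply: (measurableT_comp (f := (f : T -> T))) => //; exact: measurable_fst.
Qed.

(** Tonelli with the integral in [x] taken first: for fixed [y] it is at most [M * |u y|] times the
    [L1] norm of [phi], which is integrable in [y]. *)
Let integrable_integrand phi u f : even_kernel phi -> L1 u -> bdd_measurable f ->
  (mu \x mu)%E.-integrable setT
    (fun p : T * T => (phi (p.1 - p.2) * u p.2 * f p.1)%:E).
Proof.
move=> [hphi [mphi _] ephi] hu [mf [M fM]]; have mu_ := L1_measurable hu.
apply/integrable21ltyP; first exact: measurable_integrand.
pose C := \int[mu]_x `|phi x|.
apply: (@le_lt_trans _ _ (\int[mu]_y (C * M * `|u y|)%:E)%E); last first.
  by rewrite L1_EFin_Rintegral ?ltry//; apply: L1Z; exact: L1_abs.
apply: ge0_le_integral => //.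
- by move=> y _; exact: integral_ge0.
- apply: (measurable_fun_fubini_tonelli_G (m1 := mu)
    (fun p : T * T => `|(phi (p.1 - p.2) * u p.2 * f p.1)%:E|%E)) => //.
  by apply: measurableT_comp => //; exact: measurable_integrand.
- by apply/measurable_EFinP; apply: measurable_funM => //; exact: measurableT_comp.
move=> y _ /=.
apply: (@le_trans _ _ (\int[mu]_x (M * `|u y| * `|phi (y - x)|)%:E)%E).
  apply: ge0_le_integral => //.
  - apply/measurable_EFinP; apply: measurableT_comp => //.
    apply: measurable_funM => //; apply: measurable_funM => //.
    rewrite (_ : (fun _ => _) = (fun x => phi (y - x))); last first.
      by apply/funext => x; rewrite -ephi opprB.
    exact: measurable_fun_reflect.
  - apply/measurable_EFinP; apply: measurable_funM => //.
    by apply: measurableT_comp => //; exact: measurable_fun_reflect.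
  - move=> x _; rewrite lee_fin !normrM -(ephi (x - y)) opprB.
    by rewrite mulrC -mulrA [`|u y| * _]mulrC ler_wpM2r// mulr_ge0.
rewrite (integral_reflect y (f := fun x => (M * `|u y| * `|phi x|)%:E)); last first.
  by apply/measurable_EFinP; apply: measurable_funM => //; exact: measurableT_comp.
rewrite L1_EFin_Rintegral; last by apply: L1Z; exact: L1_abs.
by rewrite RintegralZl//; [rewrite lee_fin mulrC mulrA|exact: L1_abs].
Qed.

Lemma convol_adjoint phi u f : even_kernel phi -> L1 u -> bdd_measurable f ->
  \int[mu]_x (convol phi u x * f x) = \int[mu]_x (u x * convol phi f x).
Proof.
move=> kphi hu bf; have [hphi bphi ephi] := kphi.
congr fine; transitivity (\int[mu]_x \int[mu]_y (phi (x - y) * u y * f x)%:E)%E.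
  apply: eq_integral => x _; rewrite L1_EFin_Rintegral; last first.
    rewrite (_ : (fun _ => _) = (fun y => f x * (phi (x - y) * u y))).
      by apply: L1Z; exact: convol_integrand.
    by apply/funext => y; rewrite mulrC.
  by rewrite RintegralZr//; exact: convol_integrand.
rewrite (Fubini (integrable_integrand kphi hu bf)).
apply: eq_integral => y _.
transitivity (\int[mu]_x (u y * (phi (y - x) * f x))%:E)%E.
  by apply: eq_integral => x _ /=; rewrite -(ephi (x - y)) opprB mulrAC mulrC.
rewrite L1_EFin_Rintegral; last by apply: L1Z; exact: convol_integrandC.
by rewrite RintegralZl//; exact: convol_integrandC.
Qed.

Lemma convol_EFin phi u x : bdd_measurable phi -> L1 u ->
  ((convol phi u x)%:E = \int[mu]_y (phi (x - y) * u y)%:E)%E.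
Proof. by move=> bphi hu; rewrite L1_EFin_Rintegral//; exact: convol_integrand. Qed.

Lemma L1_convol phi u : even_kernel phi -> L1 u -> L1 (convol phi u).
Proof.
move=> kphi hu; have [_ bphi _] := kphi.
have := integrable_fubini_F (integrable_integrand kphi hu (bdd_measurable_cst 1)).
apply: eq_integrable => // x _; rewrite /fubini_F /= convol_EFin//.
by apply: eq_integral => y _; rewrite /= mulr1.
Qed.

Lemma bdd_convol phi u : even_kernel phi -> L1 u -> bdd_measurable (convol phi u).
Proof.
move=> kphi hu; have [_ bphi _] := kphi; split.
  by apply: L1_measurable; exact: L1_convol.
have [mphi [M phiM]] := bphi; exists (M * \int[mu]_y `|u y|) => x.
rewrite (le_trans (le_normr_Rintegral _ _))//; first exact: convol_integrand.
rewrite -RintegralZl//; last exact: L1_abs.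
apply: le_Rintegral => //.
- by apply: L1_abs; exact: convol_integrand.
- by apply: L1Z; exact: L1_abs.
- by move=> y _; rewrite normrM ler_wpM2r.
Qed.

Lemma convolZ phi k u x : bdd_measurable phi -> L1 u ->
  convol phi (fun y => k * u y) x = k * convol phi u x.
Proof.
move=> bphi hu; rewrite /convol -RintegralZl//; last exact: convol_integrand.
by apply: eq_Rintegral => y _; rewrite mulrCA.
Qed.

Lemma convolB phi u v x : bdd_measurable phi -> L1 u -> L1 v ->
  convol phi (fun y => u y - v y) x = convol phi u x - convol phi v x.
Proof.
move=> bphi hu hv; rewrite /convol -RintegralB//; try exact: convol_integrand.
by apply: eq_Rintegral => y _; rewrite mulrBr.
Qed.

Lemma convol_ae_kernel phi psi u : measurable_fun setT phi ->
  measurable_fun setT psi -> measurable_fun setT u ->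
  phi = psi %[ae mu] -> convol phi u = convol psi u.
Proof.
move=> mphi mpsi mu_ phipsi; apply/funext => x; apply: ae_eq_Rintegral.
- by apply: measurable_funM => //; exact: measurable_fun_reflect.
- by apply: measurable_funM => //; exact: measurable_fun_reflect.
- by apply: aeS (ae_reflect x phipsi) => y /(_ I) /= ->.
Qed.

End convolution.

(** * Functions with Lipschitz derivative, and the fundamental theorem of calculus *)

Section C11.
Context {R : realType}.
Local Notation mu := (@lebesgue_measure R).
Implicit Types (F G f g : R -> R).

(* [f] is the derivative of [F]; asking for a uniform quadratic remainder makes
   [f] Lipschitz, and the predicate stable under shifts and linear combinations. *)
Definition C11 F f :=
  exists C : R, forall x h : R, `|F (x + h) - F x - h * f x| <= C * h ^+ 2.

Lemma C11_is_derive F f (x : R) : C11 F f -> is_derive x (1 : R) F (f x).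
Proof.
move=> [C HC].
have cv : h^-1 *: ((F \o shift x) (h *: (1 : R)) - F x) @[h --> (0 : R)^'] --> f x.
  apply/subr_cvg0; apply: (@cvg_to_0_linear _ _ C 1) => // h /andP[h0 _].
  have hn0 : h != 0 by rewrite -normr_gt0.
  rewrite -(ler_pM2l h0) [leRHS]mulrCA -[X in _ <= C * X]expr2.
  rewrite real_normK ?num_real// -normrM.
  apply: le_trans (HC x h); rewrite le_eqVlt; apply/orP; left; apply/eqP.
  congr (`|_|); rewrite /= mulrBr /GRing.scale/= mulr1 addrC [x + h]addrC.
  by rewrite mulrA mulfV// mul1r addrC.
by apply: DeriveDef; [apply/cvg_ex; exists (f x)|exact/cvg_lim].
Qed.

Lemma C11_continuous F f : C11 F f -> continuous f.
Proof.
move=> [C HC] x; have C0 : 0 <= C.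
  by have := le_trans (normr_ge0 _) (HC 0 1); rewrite expr1n mulr1.
have lip h : `|f (x + h) - f x| <= 2 * C * `|h|.
  have [->|h0] := eqVneq h 0; first by rewrite addr0 subrr !normr0 mulr0.
  rewrite -(@ler_pM2l _ `|h|) ?normr_gt0// -normrM.
  (* Expanding [F] from [x] by [h] and back from [x + h] by [- h], then adding, cancels the values
     of [F]. *)
  have H1 := HC x h; have := HC (x + h) (- h); rewrite addrK sqrrN => H2.
  have -> : h * (f (x + h) - f x) = (F (x + h) - F x - h * f x) +
    (F x - F (x + h) - - h * f (x + h)) by lra.
  rewrite (le_trans (ler_normD _ _))// (le_trans (lerD H1 H2))//.
  by rewrite -(real_normK (num_real h)); lra.
apply/cvgrPdist_le => e e0; near=> y.
have yx : `|y - x| <= e / (2 * C + 1).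
  by near: y; apply: cvgr_distC_le; rewrite ?divr_gt0//; lra.
have := lip (y - x); rewrite subrKC distrC => /le_trans; apply.
move: yx; rewrite ler_pdivlMr; last lra.
by have := normr_ge0 (y - x); nra.
Unshelve. all: by end_near. Qed.

Lemma C11_cst c : C11 (fun=> c) (fun=> 0).
Proof. by exists 0 => x h; rewrite subrr mulr0 subrr normr0 mul0r. Qed.

Lemma C11D F f G g : C11 F f -> C11 G g ->
  C11 (fun x => F x + G x) (fun x => f x + g x).
Proof.
move=> [C HC] [D HD]; exists (C + D) => x h; rewrite mulrDl.
apply: le_trans (lerD (HC x h) (HD x h)); apply: le_trans (ler_normD _ _).
by rewrite le_eqVlt; apply/orP; left; apply/eqP; congr (`|_|); lra.
Qed.

Lemma C11Z k F f : C11 F f -> C11 (fun x => k * F x) (fun x => k * f x).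
Proof.
move=> [C HC]; exists (`|k| * C) => x h; rewrite mulrCA -!mulrBr normrM -mulrA.
by rewrite ler_wpM2l.
Qed.

Lemma C11B F f G g : C11 F f -> C11 G g ->
  C11 (fun x => F x - G x) (fun x => f x - g x).
Proof.
move=> hF /(C11Z (-1)) hG; have := C11D hF hG.
by congr C11; apply/funext => x; rewrite mulN1r.
Qed.

Lemma C11_shift c F f : C11 F f -> C11 (fun x => F (x + c)) (fun x => f (x + c)).
Proof. by move=> [C HC]; exists C => x h; rewrite (addrAC x). Qed.

Lemma C11_reflect c F f : C11 F f -> C11 (fun x => - F (c - x)) (fun x => f (c - x)).
Proof.
move=> [C HC]; exists C => x h; have := HC (c - x) (- h).
rewrite sqrrN -normrN => /(le_trans _); apply.
rewrite opprD addrA le_eqVlt; apply/orP; left; apply/eqP; congr (`|_|); lra.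
Qed.

Lemma C11_sum n (F f : nat -> R -> R) : (forall k, (k < n)%N -> C11 (F k) (f k)) ->
  C11 (fun x => \sum_(k < n) F k x) (fun x => \sum_(k < n) f k x).
Proof.
elim: n => [_|n IH H].
  have := C11_cst 0; congr C11; by apply/funext => x; rewrite big_ord0.
have := C11D (IH (fun k kn => H k (ltnW kn))) (H n (ltnSn n)).
by congr C11; apply/funext => x; rewrite big_ord_recr.
Qed.

Lemma C11_half_sqr_pos : C11 (fun x => Num.max 0 x ^+ 2 / 2) (Num.max 0).
Proof.
exists (2^-1) => x h; rewrite ler_norml; apply/andP.
by split; case: (leP 0 (x + h)) => ?; case: (leP 0 x) => ?; nra.
Qed.

Lemma is_derive_continuous F (x l : R) :
  is_derive x (1 : R) F l -> {for x, continuous F}.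
Proof. by case=> dF _; apply/differentiable_continuous/derivable1_diffP. Qed.

Lemma Rintegral_C1 F f a b : (forall x : R, is_derive x (1 : R) F (f x)) ->
  continuous f -> a <= b -> \int[mu]_(x in `[a, b]) f x = F b - F a.
Proof.
move=> dF cf; rewrite le_eqVlt => /predU1P[<-|ab].
  by rewrite set_itv1 Rintegral_set1 subrr.
have cF : continuous F.
  by move=> x; exact: is_derive_continuous (dF x).
rewrite /Rintegral (@continuous_FTC2 _ f F)//.
- exact: continuous_subspaceT.
- split; first by move=> x _; case: (dF x).
  + by apply: cvg_at_right_filter; exact: cF.
  + by apply: cvg_at_left_filter; exact: cF.
- by move=> x _; rewrite derive1E; case: (dF x).
Qed.

Lemma Rintegral_C11 F f a b : C11 F f -> a <= b ->
  \int[mu]_(x in `[a, b]) f x = F b - F a.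
Proof.
move=> Ff; apply: Rintegral_C1; last exact: C11_continuous Ff.
by move=> x; exact: C11_is_derive.
Qed.

End C11.

(** * The hat function and its primitive *)

Section hat.
Context {R : realType}.
Local Notation mu := (@lebesgue_measure R).
Implicit Types (h t x a b : R).

Lemma hat_maxE h x : 0 < h -> hat h x = h^-1 ^+ 2 * Num.max 0 (h - `|x|).
Proof.
move=> h0; rewrite /hat; have hV : h * h^-1 = 1 by rewrite mulfV// gt_eqF.
by case: ltP => xh; case: leP => ?; nra.
Qed.

(** The hat is [h^-2] times the second difference, of step [h], of the positive part. This is the
    same second difference of half the squared positive part: the distribution function of the hat
    seen as a probability density. *)
Definition hat_cdf h t := h^-1 ^+ 2 * (Num.max 0 (t + h) ^+ 2 / 2
  - 2 * (Num.max 0 t ^+ 2 / 2) + Num.max 0 (t - h) ^+ 2 / 2).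

Lemma C11_hat_cdf h : 0 < h -> C11 (hat_cdf h) (hat h).
Proof.
move=> h0; have H := @C11_half_sqr_pos R.
have := C11Z (h^-1 ^+ 2) (C11D (C11B (C11_shift h H) (C11Z 2 H)) (C11_shift (- h) H)).
congr C11; apply/funext => x; rewrite hat_maxE//; congr (_ * _).
case: (ger0P x) => ?; case: (leP 0 (h - _)) => ?; case: (leP 0 (x + h)) => ?;
  case: (leP 0 x) => ?; case: (leP 0 (x - h)) => ?; lra.
Qed.

Lemma hat_cdf_left h t : 0 < h -> t <= - h -> hat_cdf h t = 0.
Proof.
move=> h0 th; rewrite /hat_cdf; apply/eqP; rewrite mulf_eq0; apply/orP; right; apply/eqP.
by case: (leP 0 (t + h)) => ?; case: (leP 0 t) => ?; case: (leP 0 (t - h)) => ?; nra.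
Qed.

(** The mass beyond [t] is a triangle similar to the right half of the hat, whose area is 1/2, with
    ratio [1 - t / h]. *)
Lemma hat_cdf_tail h t : 0 < h -> 0 <= t ->
  hat_cdf h t = 1 - Num.max 0 (1 - t / h) ^+ 2 / 2.
Proof.
move=> h0 t0; have hV : h * h^-1 = 1 by rewrite mulfV// gt_eqF.
have hV0 : 0 < h^-1 by rewrite invr_gt0.
have -> : Num.max 0 (1 - t / h) = h^-1 * Num.max 0 (h - t).
  by case: (leP 0 (1 - t / h)) => ?; case: (leP 0 (h - t)) => ?; nra.
have h1 : 1 = h^-1 ^+ 2 * h ^+ 2 by rewrite -exprMn mulrC hV expr1n.
rewrite /hat_cdf exprMn [X in _ = X - _]h1 -[X in _ - X]mulrA -mulrBr; congr (_ * _).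
by case: (leP 0 (t + h)) => ?; case: (leP 0 t) => ?; case: (leP 0 (t - h)) => ?;
  case: (leP 0 (h - t)) => ?; nra.
Qed.

Lemma hat_cdfN h t : 0 < h -> hat_cdf h (- t) = 1 - hat_cdf h t.
Proof.
move=> h0; have hV : h * h^-1 = 1 by rewrite mulfV// gt_eqF.
have h1 : 1 = h^-1 ^+ 2 * h ^+ 2 by rewrite -exprMn mulrC hV expr1n.
rewrite /hat_cdf [X in _ = X - _]h1 -mulrBr; congr (_ * _).
have e1 : - t + h = - (t - h) by lra.
have e2 : - t - h = - (t + h) by lra.
have sq (y : R) : Num.max 0 (- y) ^+ 2 = y ^+ 2 - Num.max 0 y ^+ 2.
  by case: (leP 0 y) => ?; case: (leP 0 (- y)) => ?; nra.
by rewrite e1 e2 !sq; lra.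
Qed.

Lemma hat_cdf_right h t : 0 < h -> h <= t -> hat_cdf h t = 1.
Proof.
move=> h0 ht; rewrite hat_cdf_tail//; last by rewrite (le_trans (ltW h0)).
by rewrite max_l ?expr0n/= ?mul0r ?subr0// subr_le0 ler_pdivlMr// mul1r.
Qed.

Lemma hat_cdf_lt1 h t : 0 < h -> t < h -> hat_cdf h t < 1.
Proof.
move=> h0 th; have [t0|t0] := leP 0 t.
  have : 0 < 1 - t / h by rewrite subr_gt0 ltr_pdivrMr// mul1r.
  rewrite hat_cdf_tail// => th0; rewrite max_r ?ltW//; nra.
rewrite -[t]opprK hat_cdfN// hat_cdf_tail ?oppr_ge0 ?ltW//.
have : 0 < - t / h by rewrite divr_gt0 ?oppr_gt0.
by case: (leP 0 (1 - - t / h)) => ?; nra.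
Qed.

Lemma continuous_hat h : 0 < h -> continuous (hat h).
Proof. by move=> h0; exact: C11_continuous (C11_hat_cdf h0). Qed.

Lemma hat_ge0 h x : 0 < h -> 0 <= hat h x.
Proof.
by move=> h0; rewrite hat_maxE// mulr_ge0 ?sqr_ge0// le_max lexx.
Qed.

Lemma hatN h x : hat h (- x) = hat h x.
Proof. by rewrite /hat normrN. Qed.

Lemma hat_out h x : h <= `|x| -> hat h x = 0.
Proof. by rewrite /hat ltNge => ->. Qed.

Lemma hat_le h x : 0 < h -> hat h x <= h^-1.
Proof.
move=> h0; rewrite /hat; case: ifPn => _; last by rewrite invr_ge0 ltW.
by rewrite ler_piMr ?invr_ge0 ?(ltW h0)// lerBlDr lerDl divr_ge0// ltW.
Qed.

Lemma hat_mono h x y : 0 < h -> `|x| <= `|y| -> hat h y <= hat h x.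
Proof.
move=> h0 xy; rewrite !hat_maxE// ler_wpM2l ?sqr_ge0//.
by rewrite ge_max !le_max lexx/= lerD2l lerN2 xy orbT.
Qed.

Lemma even_kernel_hat h : 0 < h -> even_kernel (hat h).
Proof.
move=> h0; have mh : measurable_fun setT (hat h).
  by apply: continuous_measurable_fun; exact: continuous_hat.
split; last exact: hatN.
- apply: (@L1_le _ _ (fun x => h^-1 * \1_`[- h, h] x)) => //; last first.
    by apply: L1Z; exact: (@integrable_indic_itv R (- h) h true false).
  move=> x; rewrite (ger0_norm (hat_ge0 _ h0)) normrM.
  rewrite [`|h^-1|]ger0_norm; last by rewrite invr_ge0 ltW.
  rewrite indicE mem_setE in_itv/= -ler_norml.
  case: (leP `|x| h) => hx; first by rewrite normr1 mulr1 hat_le.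
  by rewrite (hat_out (ltW hx)) normr0 mulr0.
- split => //; exists h^-1 => x; rewrite ger0_norm ?hat_ge0//; exact: hat_le.
Qed.

Lemma convol_hat_itv h a b x : 0 < h -> a <= b ->
  convol (hat h) \1_`[a, b] x = hat_cdf h (x - a) - hat_cdf h (x - b).
Proof.
move=> h0 ab; rewrite /convol.
have := Rintegral_C11 (C11_reflect x (C11_hat_cdf h0)) ab.
rewrite opprK addrC => <-; rewrite [RHS]Rintegral_mkcond.
apply: eq_Rintegral => y _; rewrite patchE indicE.
by case: ifPn => _; rewrite ?mulr1 ?mulr0.
Qed.

Lemma convol_hat_heaviside h a x : 0 < h ->
  convol (hat h) (fun y => (a <= y)%R%:R) x = hat_cdf h (x - a).
Proof.
move=> h0; pose b := Num.max a (x + h).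
have ab : a <= b by rewrite le_max lexx.
rewrite -[RHS]subr0 -(@hat_cdf_left h (x - b))//; last first.
  by rewrite lerBlDr addrC lerBrDr le_max lexx orbT.
rewrite -convol_hat_itv//; apply: eq_Rintegral => y _; rewrite indicE mem_setE in_itv/=.
case: (leP a y) => //= ay; case: (leP y b) => // yb.
rewrite hat_out ?mul0r// ler_normr; apply/orP; right.
by move: yb; rewrite gt_max opprB => /andP[_]; lra.
Qed.

Lemma Rintegral_hat h x : 0 < h -> \int[mu]_y hat h (x - y) = 1.
Proof.
move=> h0; have := convol_hat_heaviside (x - h) x h0.
rewrite hat_cdf_right//; last lra.
move=> <-; apply: eq_Rintegral => y _.
case: (leP (x - h) y) => xy; rewrite ?mulr1// mulr0 hat_out//.
by rewrite ler_normr; apply/orP; left; lra.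
Qed.

Lemma hat_cdf_mono h a b : 0 < h -> a <= b -> hat_cdf h a <= hat_cdf h b.
Proof.
move=> h0 ab; rewrite -subr_ge0 -(Rintegral_C11 (C11_hat_cdf h0) ab).
by apply: Rintegral_ge0 => x _; exact: hat_ge0.
Qed.

Lemma hat_cdf_ge0 h t : 0 < h -> 0 <= hat_cdf h t.
Proof.
move=> h0; rewrite -(@hat_cdf_left h (Num.min t (- h)))// ?hat_cdf_mono// ge_min lexx//.
by rewrite orbT.
Qed.

Lemma hat_cdf_le1 h t : 0 < h -> hat_cdf h t <= 1.
Proof.
move=> h0; rewrite -(@hat_cdf_right h (Num.max t h))// ?hat_cdf_mono// le_max lexx//.
by rewrite orbT.
Qed.

Lemma hat_cdf_le_width (s r t : R) : 0 < s -> s <= r -> 0 <= t ->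
  hat_cdf r t <= hat_cdf s t.
Proof.
move=> s0 sr t0; have r0 := lt_le_trans s0 sr.
rewrite !hat_cdf_tail// lerD2l lerN2 ler_wpM2r ?invr_ge0//.
have : 1 - t / s <= 1 - t / r by rewrite lerD2l lerN2 ler_wpM2l// lef_pV2 ?posrE.
by case: (leP 0 (1 - t / s)) => ?; case: (leP 0 (1 - t / r)) => ?; nra.
Qed.

End hat.

(** * Total variation *)

Section total_variation.
Context {R : realType}.
Local Notation mu := (@lebesgue_measure R).
Implicit Types (u F f : R -> R) (p : nat -> R).

Lemma tv_ge_C11 u F f a b : C11 F f -> (forall x, F x != 0 -> a <= x <= b) ->
  (forall x, `|F x| <= 1) -> (\int[mu]_x (u x * f x)%:E <= tv u)%E.
Proof.
move=> Ff Fab F1; have dF (x : R) := C11_is_derive x Ff.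
have F'f : derive1 F = f by apply/funext => x; rewrite derive1E; case: (dF x).
apply: ereal_sup_ubound; exists F; last by rewrite F'f.
split => //; first by rewrite F'f; exact: C11_continuous Ff.
apply: (subclosed_compact (@closed_closure _ _) (@segment_compact _ a b)).
rewrite closureEbigcap => x; apply; split => [|y /= /Fab].
  exact: interval_closed.
by rewrite in_itv.
Qed.

Lemma tv_ge0 u : (0 <= tv u)%E.
Proof.
apply: le_trans (@tv_ge_C11 u _ _ 0 0 (C11_cst 0) _ _).
- by under eq_integral do rewrite mulr0; rewrite integral0.
- by move=> x; rewrite eqxx.
- by move=> x; rewrite normr0.
Qed.

Lemma homo_leq_seq p n : (forall k, (k < n)%N -> p k <= p k.+1) ->
  forall i j, (i <= j <= n)%N -> p i <= p j.
Proof.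
move=> hp i j /andP[/subnK <-]; elim: (j - i)%N => [|m IH] mn.
  by rewrite add0n lexx.
by rewrite (le_trans (IH (ltnW mn)))// addSn hp.
Qed.

(* Test [u] against the sum of [s_k (S (x - p_(k+1)) - S (x - p_k))], where [S] is
   [hat_cdf h] and [s_k] the sign of the [k]-th increment: its derivative picks up
   the increments of [hat h * u], and its modulus is at most 1 by telescoping. *)
Lemma variation_convol_hat u (h : R) p n : L1 u -> 0 < h ->
  (forall k, (k < n)%N -> p k <= p k.+1) ->
  ((\sum_(k < n) `|convol (hat h) u (p k.+1) - convol (hat h) u (p k)|)%:E
    <= tv u)%E.
Proof.
move=> hu h0 hp; set U := convol (hat h) u.
have hp' := homo_leq_seq hp.
pose s k := Num.sg (U (p k.+1) - U (p k)).
pose F (k : nat) x := s k * (hat_cdf h (x + - p k.+1) - hat_cdf h (x + - p k)).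
pose f (k : nat) x := s k * (hat h (x + - p k.+1) - hat h (x + - p k)).
have FC k : C11 (F k) (f k).
  by apply: C11Z; apply: C11B; apply: C11_shift; exact: C11_hat_cdf.
have mono k x : (k < n)%N -> hat_cdf h (x + - p k.+1) <= hat_cdf h (x + - p k).
  by move=> kn; rewrite hat_cdf_mono// lerD2l lerN2 hp.
have bhat := even_kernel_hat h0.
have Uhat x : U x = \int[mu]_y (u y * hat h (y + - x)).
  by apply: eq_Rintegral => y _; rewrite mulrC -hatN opprB.
have ihat x : L1 (fun y => u y * hat h (y + - x)).
  rewrite (_ : (fun _ => _) = fun y => hat h (x - y) * u y).
    by apply: convol_integrand => //; case: bhat.
  by apply/funext => y; rewrite mulrC -hatN opprB.
have If k : L1 (fun y => s k * (u y * hat h (y + - p k.+1) - u y * hat h (y + - p k))).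
  by apply: L1Z; exact: L1B.
have iE : (\int[mu]_y (u y * \sum_(k < n) f k y)%:E =
    (\sum_(k < n) `|U (p k.+1) - U (p k)|)%:E)%E.
  under eq_integral => y _.
    rewrite (_ : _ * _ = \sum_(k < n)
      (s k * (u y * hat h (y + - p k.+1) - u y * hat h (y + - p k)))); last first.
      by rewrite mulr_sumr; apply: eq_bigr => k _; rewrite mulrCA mulrBr.
    rewrite -sumEFin; over.
  rewrite integral_sum//; last by move=> k; exact: If.
  rewrite -sumEFin; apply: eq_bigr => k _.
  rewrite L1_EFin_Rintegral//; congr (_%:E).
  rewrite RintegralZl//; last exact: L1B.
  rewrite RintegralB//; [|exact: ihat..].
  by rewrite /s -Uhat -Uhat -normrEsg.
rewrite -iE; apply: (@tv_ge_C11 u (fun x => \sum_(k < n) F k x) _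
  (p 0%N - h) (p n + h)).
- by apply: C11_sum => k _; exact: FC.
- move=> x; apply: contraR; rewrite negb_and -!ltNge => xh.
  apply/eqP; rewrite big1// => -[k kn] _; rewrite /F /=.
  have k1 : p 0%N <= p k by apply: hp'; rewrite leq0n ltnW.
  have k2 : p k <= p k.+1 by exact: hp.
  have k3 : p k.+1 <= p n by apply: hp'; rewrite kn leqnn.
  by case/orP: xh => xh; [rewrite !hat_cdf_left//|rewrite !hat_cdf_right//];
    rewrite ?subrr ?mulr0//; lra.
- move=> x; rewrite (le_trans (ler_norm_sum _ _ _))//.
  apply: (@le_trans _ _ (\sum_(k < n) - (hat_cdf h (x + - p k.+1) - hat_cdf h (x + - p k)))).
    apply: ler_sum => -[k kn] _; rewrite /F normrM /=.
    rewrite [X in _ * X]ler0_norm ?subr_le0 ?mono//.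
    by rewrite ler_piMl ?oppr_ge0 ?subr_le0 ?mono// normr_sg; case: (_ != 0).
  rewrite sumrN -(big_mkord xpredT
    (fun k => hat_cdf h (x + - p k.+1) - hat_cdf h (x + - p k))).
  rewrite (@telescope_sumr _ _ _ (fun k => hat_cdf h (x + - p k)))//.
  by have := hat_cdf_ge0 (x + - p n) h0; have := hat_cdf_le1 (x + - p 0%N) h0; lra.
Qed.

(** The hat is at most [h^-1] on a ball of measure [2 * h] and 0 outside it, so the error is at most
    twice the mean deviation [davg u x h], which tends to 0 at a Lebesgue point. *)
Lemma convol_hat_lebesgue_pt u x : L1 u -> lebesgue_pt u x ->
  convol (hat h) u x @[h --> (0 : R)^'+] --> u x.
Proof.
move=> hu ux.
have key (h : R) : 0 < h -> ((`|convol (hat h) u x - u x|)%:E <= 2%:E * davg u x h)%E.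
  move=> h0; have [hhat bhat _] := even_kernel_hat h0.
  have i1 := convol_integrand x bhat hu.
  have i2 : L1 (fun y => u x * hat h (x - y)) by apply: L1Z; exact: L1_reflect.
  have mb : measurable (ball x h) by exact: measurable_ball.
  have -> : convol (hat h) u x - u x = \int[mu]_y (hat h (x - y) * u y - u x * hat h (x - y)).
    by rewrite RintegralB// RintegralZl ?Rintegral_hat ?mulr1//; exact: L1_reflect.
  rewrite EFin_normr_Rintegral//; last exact: L1B.
  apply: le_trans (le_abse_integral _ _ _) _ => //.
    by apply/measurable_EFinP; apply: measurable_funB; exact: L1_measurable.
  rewrite /davg /iavg (lebesgue_measure_ball x (ltW h0)) inver mulrn_eq0/= gt_eqF//.
  rewrite muleA -EFinM (_ : 2 * _ = h^-1); last first.
    by rewrite -[h *+ 2]mulr_natl invfM mulrA mulfV ?mul1r.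
  rewrite -ge0_integralZl//; last 2 first.
  - apply/measurable_EFinP/measurable_funTS; apply: measurableT_comp => //.
    by apply: measurable_funB => //; exact: L1_measurable.
  - by rewrite lee_fin invr_ge0 ltW.
  rewrite [leRHS]integral_mkcond; apply: ge0_le_integral => //.
  - apply/measurable_EFinP; apply: measurableT_comp => //.
    by apply: measurable_funB; exact: L1_measurable.
  - apply/(measurable_restrictT _ _).1 => //; apply: measurable_funeM.
    apply/measurable_EFinP/measurable_funTS; apply: measurableT_comp => //.
    by apply: measurable_funB => //; exact: L1_measurable.
  move=> y _; rewrite patchE; case: ifPn => /=.
    rewrite lee_fin mulrC -mulrBl normrM mulrC (ger0_norm (hat_ge0 _ h0)) => _.
    by rewrite ler_wpM2r ?hat_le// distrC.
  rewrite notin_setE /ball/= => /negP; rewrite -leNgt => hxy.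
  by rewrite hat_out ?mulr0 ?mul0r ?subrr ?normr0.
apply/cvgrPdist_le => e e0.
have e20 : (0 < (e / 2)%:E)%E by rewrite lte_fin divr_gt0.
have : \forall h \near (0 : R)^'+, (davg u x h < (e / 2)%:E)%E.
  have := ux; rewrite /lebesgue_pt => /(_ [set y | (y < (e / 2)%:E)%E]); apply.
  by apply: open_nbhs_nbhs; split; [exact: open_ereal_lt_ereal|].
move=> davge; near=> h.
have h0 : 0 < h by near: h; exact: nbhs_right_gt.
rewrite distrC -lee_fin (le_trans (key h h0))//.
rewrite (@le_trans _ _ (2%:E * (e / 2)%:E)%E)//.
  by rewrite lee_pmul2l// ltW//; near: h.
by rewrite -EFinM lee_fin; lra.
Unshelve. all: by end_near. Qed.

(** The limit of [variation_convol_hat] as [h] tends to 0. It replaces the choice of a good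
    representative of [u]. *)
Lemma variation_lebesgue_pt u p n : L1 u ->
  (forall k, (k < n)%N -> p k <= p k.+1) ->
  (forall k, (k <= n)%N -> lebesgue_pt u (p k)) ->
  ((\sum_(k < n) `|u (p k.+1) - u (p k)|)%:E <= tv u)%E.
Proof.
move=> hu hp pL; have := tv_ge0 u.
case E : (tv u) => [c| |]//= _; rewrite ?leey//.
have cv m : (m <= n)%N ->
  \sum_(k < m) `|convol (hat h) u (p k.+1) - convol (hat h) u (p k)|
    @[h --> (0 : R)^'+] --> \sum_(k < m) `|u (p k.+1) - u (p k)|.
  elim: m => [_|m IH mn].
    by rewrite big_ord0; under eq_cvg do rewrite big_ord0; exact: cvg_cst.
  rewrite big_ord_recr/=; under eq_cvg do rewrite big_ord_recr/=.
  apply: cvgD; first exact/IH/ltnW.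
  by apply: cvg_norm; apply: cvgB; apply: convol_hat_lebesgue_pt => //;
    apply: pL => //; exact: ltnW.
rewrite lee_fin; apply: (cvgr_to_le (cv n (leqnn n))).
near=> h; rewrite -lee_fin -E; exact: variation_convol_hat.
Unshelve. all: by end_near. Qed.

Lemma ae_lebesgue_pt u : L1 u -> \forall x \ae mu, lebesgue_pt u x.
Proof.
move=> hu; apply: lebesgue_differentiation.
by apply: open_integrable_locally => //; exact: openT.
Qed.

End total_variation.

(** * Homogeneity of the total variation, and functions of zero variation *)

Section tv_properties.
Context {R : realType}.
Local Notation mu := (@lebesgue_measure R).
Implicit Types (u v phi : R -> R).

Lemma tv_test_support phi : tv_test phi -> exists2 B : R, 0 < B &
  forall x, B < `|x| -> phi x = 0 /\ derive1 phi x = 0.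
Proof.
move=> [dphi cphi /compact_bounded /pinfty_ex_gt0[B B0 HB] _]; exists B => //.
have phi0 x : B < `|x| -> phi x = 0.
  move=> Bx; apply: contrapT => /eqP px.
  by have := HB x (@subset_closure _ [set x : R | phi x != 0] x px); rewrite /= leNgt Bx.
move=> x Bx; split; first exact: phi0.
rewrite derive1E (@near_eq_derive _ _ _ phi (cst 0)) ?derive_cst//.
have : \forall y \near x, B < `|y|.
  have cx : `|y| @[y --> x] --> `|x| by apply: cvg_norm; exact: cvg_id.
  exact: cvgr_gt cx _ Bx.
by apply: filterS => y /phi0.
Qed.

Lemma tv_test_bdd_derive1 phi : tv_test phi -> bdd_measurable (derive1 phi).
Proof.
move=> tphi; have [B B0 phiB] := tv_test_support tphi.
have [_ cphi _ _] := tphi; split; first exact: continuous_measurable_fun.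
have BB : - B <= B by lra.
have [|c _ Hc] := @EVT_max _ (fun x => `|derive1 phi x|) _ _ BB.
  by apply: continuous_subspaceT => x; apply: cvg_norm; exact: cphi.
exists `|derive1 phi c| => x; have [xB|xB] := leP `|x| B.
  by apply: Hc; rewrite in_itv/= -ler_norml.
by rewrite (phiB x xB).2 normr0.
Qed.

Lemma derive1_opp phi : (forall x : R, derivable phi x 1) ->
  derive1 (fun x => - phi x) = fun x => - derive1 phi x.
Proof. by move=> dphi; apply/funext => x; rewrite !derive1E (deriveN (dphi x)). Qed.

Lemma tv_testN phi : tv_test phi -> tv_test (fun x => - phi x).
Proof.
move=> tphi; have [dphi cphi kphi phi1] := tphi.
have E := derive1_opp dphi.
split.
- by move=> x; exact: derivableN.
- by rewrite E => x; apply: continuousN; exact: cphi.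
- by rewrite (_ : [set x | - phi x != 0] = [set x | phi x != 0])//;
    apply/seteqP; split=> x /=; rewrite oppr_eq0.
- by move=> x; rewrite normrN.
Qed.

(** For negative [k] the sign is moved to the test function. Used twice with [k = -1], the
    inequality gives invariance of [tv] under change of sign. *)
Lemma tvZ_le (k : R) u : L1 u -> (tv (fun x => k * u x)%R <= `|k|%:E * tv u)%E.
Proof.
move=> hu; apply: ge_ereal_sup => _ [phi tphi <-].
have hup psi : tv_test psi -> L1 (fun x => u x * derive1 psi x).
  move=> /tv_test_bdd_derive1 bpsi; rewrite (_ : (fun _ => _) = fun x => derive1 psi x * u x).
    exact: L1_mul.
  by apply/funext => x; rewrite mulrC.
have H psi (r : R) : 0 <= r -> tv_test psi ->
    (\int[mu]_x (r * u x * derive1 psi x)%:E <= r%:E * tv u)%E.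
  move=> r0 tpsi; under eq_integral do rewrite -mulrA.
  rewrite L1_EFin_Rintegral; last by apply: L1Z; exact: hup.
  rewrite RintegralZl//; last exact: hup.
  rewrite EFinM lee_wpmul2l ?lee_fin// -L1_EFin_Rintegral; last exact: hup.
  by apply: ereal_sup_ubound; exists psi.
have [k0|k0] := ger0P k; first exact: H.
under eq_integral => x _.
  rewrite (_ : _ * _ = (- k) * u x * derive1 (fun x => - phi x) x); last first.
    by rewrite derive1_opp; [lra|case: tphi].
  over.
by apply: H; [lra|exact: tv_testN].
Qed.

Lemma L1_ae_cst u c : L1 u -> u = cst c %[ae mu] -> c = 0.
Proof.
move=> hu uc; have : L1 (cst c : R -> R) by apply: L1_ae uc hu; exact: measurable_cst.
move=> /integrableP[_]; rewrite [X in (X < _)%E -> _](_ : _ = `|c|%:E * mu setT)%E.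
  apply: contraPP => /eqP c0; rewrite -set_itvNyy lebesgue_measure_itv/=.
  by rewrite muleC mulyr gtr0_sg ?normr_gt0// mul1e ltxx.
by rewrite -integral_cst.
Qed.

Lemma ae_exists (P : R -> Prop) a b : a < b -> (\forall x \ae mu, P x) ->
  exists2 x, a < x < b & P x.
Proof.
move=> ab [A [mA A0 PA]]; apply: contrapT => H.
have : (mu `]a, b[%classic <= 0)%E.
  rewrite -A0; apply: le_measure; rewrite ?inE//.
  by move=> x /=; rewrite in_itv/= => xab; apply: PA => /= Px; apply: H; exists x.
by rewrite lebesgue_measure_itv/= lte_fin ab -EFinD lee_fin leNgt subr_gt0 ab.
Qed.

(** Chains of two points show that [u] takes a single value on its Lebesgue points, and
    integrability over the whole line forces this value to be 0. *)
Lemma tv_eq0 u : L1 u -> tv u = 0%E -> u = cst 0 %[ae mu].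
Proof.
move=> hu tu; have aeL := ae_lebesgue_pt hu.
have [x0 _ Lx0] := ae_exists ltr01 aeL.
have uE x y : x <= y -> lebesgue_pt u x -> lebesgue_pt u y -> u x = u y.
  move=> xy Lx Ly; pose p k := if k is 0%N then x else y.
  have := @variation_lebesgue_pt _ u p 1 hu; rewrite big_ord1 tu lee_fin => H.
  apply/eqP; rewrite eq_sym -subr_eq0 -normr_le0; by apply: H => -[].
have uc : u = cst (u x0) %[ae mu].
  apply: aeS aeL => x Lx _ /=; case: (leP x x0) => xx0; first exact: uE.
  by apply/esym/uE => //; exact: ltW.
by rewrite -(L1_ae_cst hu uc).
Qed.

End tv_properties.

(** * The energy and its minimiser at zero *)

Section energy.
Context {R : realType}.
Local Notation mu := (@lebesgue_measure R).
Implicit Types (u v f g phi : R -> R).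

Lemma Lnorm2_sqr g : L1 g -> bdd_measurable g ->
  ('N[mu]_2%:E [EFin \o g] ^+ 2 = (\int[mu]_x (g x ^+ 2))%:E)%E.
Proof.
move=> hg bg.
have I0 : 0 <= \int[mu]_x (g x ^+ 2) by apply: Rintegral_ge0 => x _; exact: sqr_ge0.
rewrite unlock /=.
under eq_integral => x _.
  rewrite powR_mulrn// real_normK ?num_real//; over.
rewrite L1_EFin_Rintegral; last exact: (L1_mul bg hg).
by rewrite poweR_EFin powR12_sqrt// -EFinM -expr2 sqr_sqrtr.
Qed.

Lemma F3E (lambda : R) phi f u : even_kernel phi -> L1 f -> bdd_measurable f ->
  L1 u -> F3 lambda phi f u =
    (tv u + (lambda * \int[mu]_x ((convol phi u x - f x) ^+ 2))%:E)%E.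
Proof.
move=> kphi hf bf hu; rewrite /F3 Lnorm2_sqr//.
  by apply: L1B => //; exact: L1_convol.
by apply: bdd_measurableB => //; exact: bdd_convol.
Qed.

Lemma L1_sqr g : L1 g -> bdd_measurable g -> L1 (fun x => g x ^+ 2).
Proof. by move=> hg bg; exact: (L1_mul bg hg). Qed.

Lemma Rintegral_sqrB f g : L1 f -> bdd_measurable f -> L1 g -> bdd_measurable g ->
  \int[mu]_x ((f x - g x) ^+ 2) =
  \int[mu]_x (f x ^+ 2) - 2 * \int[mu]_x (f x * g x) + \int[mu]_x (g x ^+ 2).
Proof.
move=> hf bf hg bg.
have h1 := L1_sqr hf bf; have h2 := L1_sqr hg bg; have h3 := L1_mul bf hg.
have h4 := L1Z 2 h3.
rewrite -RintegralZl// -RintegralB// -RintegralD//; last exact: L1B.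
by apply: eq_Rintegral => x _; lra.
Qed.

Lemma fidelityE phi f u : even_kernel phi -> L1 f -> bdd_measurable f -> L1 u ->
  \int[mu]_x ((convol phi u x - f x) ^+ 2) =
  \int[mu]_x (convol phi u x ^+ 2) - 2 * \int[mu]_x (u x * convol phi f x)
    + \int[mu]_x (f x ^+ 2).
Proof.
move=> kphi hf bf hu; rewrite Rintegral_sqrB//; [|exact: L1_convol|exact: bdd_convol].
by rewrite convol_adjoint.
Qed.

Lemma L1_cst0 : L1 (cst 0 : R -> R).
Proof. exact: integrable0. Qed.

Lemma tv_cst0 : tv (cst 0 : R -> R) = 0%E.
Proof.
apply/eqP; rewrite eq_le tv_ge0 andbT; apply: ge_ereal_sup => _ [phi _ <-].
by under eq_integral do rewrite mul0r; rewrite integral0.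
Qed.

Lemma convol_cst0 phi x : convol phi (cst 0) x = 0.
Proof.
rewrite /convol /Rintegral.
by under eq_integral do rewrite mulr0; rewrite integral0.
Qed.

Lemma F3_cst0 (lambda : R) phi f : even_kernel phi -> L1 f -> bdd_measurable f ->
  F3 lambda phi f (cst 0) = (lambda * \int[mu]_x (f x ^+ 2))%:E.
Proof.
move=> kphi hf bf; rewrite F3E//; last exact: L1_cst0.
rewrite tv_cst0 add0e; congr (_ * _)%:E; apply: eq_Rintegral => x _.
by rewrite convol_cst0 sub0r sqrrN.
Qed.

Lemma BVR_cst0 : BVR (cst 0 : R -> R).
Proof. by split; [exact: L1_cst0|rewrite tv_cst0 ltry]. Qed.

(** Homogeneity removes the normalisation [tv v <= 1], and replacing [v] by its opposite removes the
    absolute value. A function of zero variation cannot be normalised, but it vanishes by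
    [tv_eq0]. *)
Lemma dual_norm_le g (c : R) : L1 g -> bdd_measurable g -> 0 <= c ->
  (dual_norm g <= c%:E)%E <->
  forall u (t : R), L1 u -> tv u = t%:E -> \int[mu]_x (u x * g x) <= c * t.
Proof.
move=> hg bg c0.
have Ig u : L1 u -> (\int[mu]_x (g x * u x)%:E = (\int[mu]_x (u x * g x))%:E)%E.
  move=> hu; rewrite L1_EFin_Rintegral; last exact: L1_mul.
  by congr (_%:E); apply: eq_Rintegral => x _; rewrite mulrC.
have Lg u : L1 u -> L1 (fun x => u x * g x).
  move=> hu; rewrite (_ : (fun _ => _) = fun x => g x * u x); first exact: L1_mul.
  by apply/funext => x; rewrite mulrC.
split=> [Dg u t hu tu|H].
  have t0 : 0 <= t by rewrite -lee_fin -tu tv_ge0.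
  have [t00|tn0] := eqVneq t 0.
    have u0 : u = cst 0 %[ae mu] by apply: tv_eq0; rewrite // tu t00.
    rewrite (@ae_eq_Rintegral _ _ (cst 0)).
    - by rewrite /Rintegral integral0 t00 mulr0.
    - exact: L1_measurable (Lg u hu).
    - exact: measurable_cst.
    - by apply: aeS u0 => x /(_ I) /= -> _; rewrite mul0r.
  have tp : 0 < t by rewrite lt_neqAle eq_sym tn0.
  have hv : L1 (fun x => t^-1 * u x) by exact: L1Z.
  have : (`| \int[mu]_x (g x * (t^-1 * u x))%:E | <= c%:E)%E.
    apply: le_trans Dg; apply: ereal_sup_ubound; exists (fun x => t^-1 * u x) => //.
    split=> //; apply: (le_trans (tvZ_le _ hu)).
    by rewrite tu -EFinM lee_fin ger0_norm ?invr_ge0// mulVf.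
  rewrite Ig// abse_EFin lee_fin => /(le_trans (ler_norm _)).
  under eq_Rintegral do rewrite -mulrA.
  by rewrite RintegralZl ?Lg// ler_pdivrMl// mulrC.
apply: ge_ereal_sup => _ [v [hv tv1] <-].
rewrite Ig// abse_EFin lee_fin.
have [t tE] : exists t, tv v = t%:E.
  by have := tv_ge0 v; move: tv1; case: (tv v) => // t _ _; exists t.
have t1 : t <= 1 by rewrite -lee_fin -tE.
have ct : c * t <= c by rewrite ler_piMr.
rewrite ler_norml (le_trans (H v t hv tE) ct) andbT.
have hNv : L1 (fun x => -1 * v x) by exact: L1Z.
have tNE : tv (fun x => -1 * v x) = t%:E.
  apply/eqP; rewrite eq_le; apply/andP; split.
    by apply: le_trans (tvZ_le _ hv) _; rewrite normrN1 mul1e tE.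
  rewrite -tE [X in tv X](_ : _ = fun x => -1 * (-1 * v x)); last first.
    by apply/funext => x; lra.
  by apply: le_trans (tvZ_le _ hNv) _; rewrite normrN1 mul1e.
have := le_trans (H _ t hNv tNE) ct.
under eq_Rintegral do rewrite -mulrA.
by rewrite RintegralZl ?Lg// mulN1r lerNl.
Qed.

Lemma zero_unique_minimiser (lambda : R) phi f : 0 < lambda ->
  even_kernel phi -> L1 f -> bdd_measurable f ->
  is_unique_minimiser (F3 lambda phi f) BVR (cst 0)
  <-> (dual_norm (convol phi f) <= ((2 * lambda)^-1)%:E)%E.
Proof.
move=> l0 kphi hf bf.
have l20 : 0 < 2 * lambda by rewrite mulr_gt0.
have hg := L1_convol kphi hf; have bg := bdd_convol kphi hf.
rewrite dual_norm_le ?invr_ge0 ?(ltW l20)//.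
pose Q u := \int[mu]_x (convol phi u x ^+ 2).
pose J u := \int[mu]_x (u x * convol phi f x).
have Q0 u : 0 <= Q u by apply: Rintegral_ge0 => x _; exact: sqr_ge0.
have FE u (t : R) : L1 u -> tv u = t%:E -> F3 lambda phi f u =
    (t + lambda * (Q u - 2 * J u) + lambda * \int[mu]_x (f x ^+ 2))%:E.
  move=> hu tu; rewrite F3E// tu fidelityE// -EFinD; congr (_%:E).
  by rewrite mulrDr addrA.
split=> [[[_ min0] _] u t hu tu|H].
  rewrite ler_pdivlMl// leNgt; apply/negP => tJ.
  pose e := 2 * lambda * J u - t.
  have e0 : 0 < e by rewrite subr_gt0.
  (* With [s * (lambda * Q u + 1) = e], the energy of [s u] exceeds that of 0 by at most
     [s * (s * lambda * Q u - e) = - s ^+ 2], a contradiction; the added 1 keeps the denominator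
     positive. *)
  pose s := e / (lambda * Q u + 1).
  have q1 : 0 < lambda * Q u + 1.
    apply: ltr_wpDl; last exact: ltr01.
    by apply: mulr_ge0; [exact: ltW l0|exact: Q0].
  have s0 : 0 < s by rewrite divr_gt0.
  have hs : L1 (fun x => s * u x) by exact: L1Z.
  have tvs := tvZ_le s hu; rewrite tu -EFinM (ger0_norm (ltW s0)) in tvs.
  have := min0 (fun x => s * u x); rewrite F3_cst0// => min.
  have {}min := min (conj hs (le_lt_trans tvs (ltry _))).
  have [r rE] : exists r, tv (fun x => s * u x) = r%:E.
    by have := tv_ge0 (fun x => s * u x); move: tvs; case: (tv _) => // r _ _; exists r.
  move: tvs min; rewrite (FE _ r)// rE !lee_fin => rst.
  have -> : Q (fun x => s * u x) = s ^+ 2 * Q u.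
    rewrite /Q -RintegralZl//; last first.
      by apply: L1_sqr; [exact: L1_convol|exact: bdd_convol].
    apply: eq_Rintegral => x _; rewrite convolZ ?exprMn//; by case: kphi.
  have -> : J (fun x => s * u x) = s * J u.
    rewrite /J -RintegralZl//; last first.
      rewrite (_ : (fun _ => _) = fun x => convol phi f x * u x); first exact: L1_mul.
      by apply/funext => x; rewrite mulrC.
    by apply: eq_Rintegral => x _; rewrite mulrA.
  have sE : s * (lambda * Q u + 1) = e by rewrite /s mulfVK// gt_eqF.
  rewrite /e in sE; nra.
split.
  split; first exact: BVR_cst0.
  move=> u [hu tu]; rewrite F3_cst0//.
  have [t tE] : exists t, tv u = t%:E.
    by have := tv_ge0 u; move: tu; case: (tv u) => // t _ _; exists t.
  rewrite (FE u t)// lee_fin.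
  by have := H u t hu tE; rewrite ler_pdivlMl// -/(J u) => ?; have := Q0 u; nra.
move=> v [[hv tv_v] minv].
have [t tE] : exists t, tv v = t%:E.
  by have := tv_ge0 v; move: tv_v; case: (tv v) => // t _ _; exists t.
have t0 : 0 <= t by rewrite -lee_fin -tE tv_ge0.
have := minv _ BVR_cst0; rewrite F3_cst0// (FE v t)// lee_fin => Fle.
have := H v t hv tE; rewrite ler_pdivlMl// -/(J v) => HJ.
(* Minimality reads [t + lambda * (Q v - 2 * J v) <= 0], and [2 * lambda * J v <= t], so [Q v]
   vanishes. Then [convol phi v] is null, [J v] vanishes by adjointness, and [t <= 0] remains. *)
have Qv : Q v = 0 by have := Q0 v; nra.
have hK := L1_convol kphi hv; have bK := bdd_convol kphi hv.
have K0 : convol phi v = cst 0 %[ae mu].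
  have := @Rintegral_ge0_eq0 _ _ (L1_sqr hK bK) _ _.
  rewrite [X in (_ -> X <= _ -> _) -> _]Qv lexx => /(_ _ erefl) K2.
  have : \forall x \ae mu, 0 <= convol phi v x ^+ 2 by apply: aeW => x; exact: sqr_ge0.
  by move/K2; apply: aeS => x /eqP; rewrite sqrf_eq0 => /eqP.
have Jv : J v = 0.
  rewrite /J -convol_adjoint// (@ae_eq_Rintegral _ _ (cst 0)).
  - by rewrite /Rintegral integral0.
  - by apply: measurable_funM; [exact: (L1_measurable hK)|exact: (L1_measurable hf)].
  - exact: measurable_cst.
  - by apply: aeS K0 => x /(_ I) /= -> _; rewrite mul0r.
apply: tv_eq0 => //; rewrite tE; congr (_%:E).
by move: Fle; rewrite Qv Jv; nra.
Qed.

(** A kernel of the class is even and bounded by [p 0] only almost everywhere. Clipping [phi] at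
    [p 0] and averaging it with its reflection gives a representative with everywhere valid bounds
    and symmetry; measurability is inherited from [phi], so that of [p] is never discussed. *)
Lemma kernel_class_even (sigma : R) phi : 0 < sigma -> kernel_class sigma phi ->
  exists2 psi, even_kernel psi & phi = psi %[ae mu].
Proof.
move=> s0 [hphi [p [p0 pmono _ phiE]]].
have pos0 : (0 : R) \in `[0, sigma] by rewrite in_itv/= lexx ltW.
have mphi := L1_measurable hphi.
pose c x := Num.max (- p 0) (Num.min (p 0) (phi x)).
have mc : measurable_fun setT c.
  by apply: measurable_maxr => //; apply: measurable_minr.
have cM x : `|c x| <= p 0.
  have := p0 0 pos0; rewrite /c => ?.
  rewrite ler_norml le_max lexx /= ge_max ge_min lexx /= andbT; lra.
(* At 0 both indicators are 1 and the formula gives [2 * p 0], above the clipping level, so this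
   point is set aside. *)
have n0 : \forall x \ae mu, x != 0.
  exists [set (0 : R)]; split; first exact: measurable_set1.
    exact: lebesgue_measure_set1.
  by move=> x /= /negP; rewrite negbK => /eqP.
pose q x := p (- x) * \1_(`[- sigma, 0]) x + p x * \1_(`[0, sigma]) x.
have qN x : q (- x) = q x.
  rewrite /q opprK !indicE !mem_setE !in_itv/= addrC !oppr_le0 !oppr_ge0.
  by rewrite lerN2 lerNl [(0 <= x) && _]andbC [(- sigma <= x) && _]andbC.
have qM x : x != 0 -> 0 <= q x <= p 0.
  move=> xn0; rewrite /q !indicE !mem_setE !in_itv/=.
  have pin y : 0 <= y <= sigma -> 0 <= p y <= p 0.
    move=> hy; have yin : y \in `[0, sigma] by rewrite in_itv.
    by rewrite p0// pmono//; case/andP: hy.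
  case: (ltgtP x 0) xn0 => // x0 _; rewrite ?andbF ?andbT/= ?mulr0 ?addr0 ?add0r.
    case: (leP (- sigma) x) => hx; rewrite /= ?mulr0 ?mulr1 ?pin ?lexx ?p0//.
    by apply/andP; split; lra.
  case: (leP x sigma) => hx; rewrite /= ?mulr0 ?mulr1 ?pin ?lexx ?p0//.
  by apply/andP; split; lra.
have cphi : \forall x \ae mu, c x = phi x.
  apply: aeS2 n0 phiE => x xn0 /(_ I) /= phix; have := qM x xn0.
  rewrite /c phix -/(q x) => /andP[q0 q1].
  by rewrite min_r// max_r//; lra.
have ceven : \forall x \ae mu, c (- x) = c x.
  have cq : \forall x \ae mu, c x = q x by apply: aeS2 cphi phiE => x -> /(_ I).
  by apply: aeS2 cq (ae_reflect 0 cq) => x ->; rewrite sub0r qN.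
pose psi x := 2^-1 * (c x + c (0 - x)).
have mpsi : measurable_fun setT psi.
  apply: measurable_funM => //; apply: measurable_funD => //.
  exact: measurable_fun_reflect.
have phipsi : phi = psi %[ae mu].
  by apply: aeS2 cphi ceven => x h1 h2 _; rewrite /psi sub0r h2 h1; lra.
exists psi => //; split.
- exact: L1_ae hphi.
- split=> //; exists (p 0) => x; rewrite /psi.
  by have := cM x; have := cM (0 - x); rewrite !ler_norml => /andP[? ?] /andP[? ?];
    apply/andP; split; lra.
- by move=> x; rewrite /psi !sub0r opprK addrC.
Qed.

End energy.

(** * Edges of a bar code *)

Section barcode_structure.
Context {R : realType}.
Local Notation mu := (@lebesgue_measure R).
Implicit Types (z : R -> R) (s : seq R).

Lemma ae_notin s : \forall x \ae mu, x \notin s.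
Proof.
elim: s => [|y s IH]; first exact: aeW.
have ny : \forall x \ae mu, x != y.
  exists [set y]; split; first exact: measurable_set1.
    exact: lebesgue_measure_set1.
  by move=> x /= /negP; rewrite negbK => /eqP.
by apply: aeS2 ny IH => x xy xs; rewrite inE negb_or xy.
Qed.

(* Equal entries cancel in pairs. *)
Lemma odd_count_sorted s : exists2 s', sorted <%R s' &
  forall x, odd (count (<= x) s') = odd (count (<= x) s).
Proof.
elim: s => [|a s [s' ss' E]]; first by exists [::].
have [as'|as'] := boolP (a \in s').
  exists (rem a s').
    by apply: (subseq_sorted lt_trans) ss'; exact: rem_subseq.
  move=> x; rewrite /= oddD -E; have /permP -> := perm_to_rem as'.
  by rewrite /= !oddD addbA addbb.
exists (sort <=%R (a :: s')).
  rewrite lt_sorted_uniq_le sort_uniq /= as' (sort_sorted le_total) andbT.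
  by apply: lt_sorted_uniq.
move=> x; have /permP -> : perm_eq (sort <=%R (a :: s')) (a :: s') by rewrite perm_sort.
by rewrite /= !oddD E.
Qed.

Lemma count_iota_le v M : (v <= M)%N -> count (fun k => k <= v)%N (iota 1 M) = v.
Proof.
move=> vM; rewrite -(subnKC vM) iotaD count_cat.
rewrite (_ : count _ (iota 1 v) = v); last first.
  rewrite -[RHS](size_iota 1 v); apply/eqP; rewrite -all_count.
  by apply/allP => k; rewrite mem_iota add1n ltnS => /andP[].
rewrite -[RHS]addn0; congr (_ + _)%N; apply/eqP; rewrite -leqn0 leqNgt -has_count.
by apply/hasPn => k; rewrite mem_iota add1n -ltnNge => /andP[].
Qed.

(** The jumps are the infima of the superlevel sets [k <= V x] for [k] from 1 to [M]; a jump of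
    height greater than one is listed several times. At an infimum itself the level may or may not
    be reached, hence the exclusion of the points of [s]. *)
Lemma step_jumps (V : R -> nat) (M : nat) (b : R) :
  {homo V : x y / x <= y >-> (x <= y)%N} -> (forall x, (V x <= M)%N) ->
  (forall x, (0 < V x)%N -> b <= x) -> (exists x, V x = M) ->
  exists s, forall x, x \notin s -> count (<= x) s = V x.
Proof.
move=> hV VM Vb [xM VxM].
pose A k := [set x | (k <= V x)%N].
pose y k := inf (A k).
have hA k : (0 < k <= M)%N -> has_inf (A k).
  move=> /andP[k0 kM]; split; first by exists xM; rewrite /A /= VxM.
  by exists b => x /= kV; apply: Vb; exact: leq_trans kV.
exists [seq y k | k <- iota 1 M] => x xs; rewrite count_map.
rewrite -[RHS](@count_iota_le _ M)//; apply: eq_in_count => k.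
rewrite mem_iota add1n ltnS => kM /=; have [A0 Ab] := hA k kM.
have yx : y k != x.
  by apply: contra xs => /eqP <-; apply: map_f; rewrite mem_iota add1n ltnS.
apply/idP/idP => [yk|kV]; last by apply: (ge_inf (hA k kM).2).
have : y k < x by rewrite lt_neqAle yx.
by move=> /(inf_lt A0) [t /= kt tx]; apply: leq_trans kt (hV _ _ (ltW tx)).
Qed.

(* On the Lebesgue points of [z], the longest chain of points below [x] on which
   [z] alternates between 0 and 1 has a length [V x] of the parity of [z x], bounded
   by [tv z]; the jumps of the monotone function [V] are the edges of [z]. *)
Lemma barcode_parity z : barcode z -> exists2 s, sorted <%R s &
  \forall x \ae mu, z x = (odd (count (<= x) s))%:R.
Proof.
move=> [[hz tz] z01 zout].
pose G x := [/\ lebesgue_pt z x, z x = 0 \/ z x = 1 & x < 0 -> z x = 0].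
have aeG : \forall x \ae mu, G x.
  have zneg : \forall x \ae mu, x < 0 -> z x = 0.
    apply: aeS zout => x H x0; apply: H => /=; rewrite in_itv/= => /andP[].
    by rewrite leNgt x0.
  have zz : \forall x \ae mu, (z x = 0 \/ z x = 1) /\ (x < 0 -> z x = 0).
    by apply: aeS2 z01 zneg => x.
  by apply: aeS2 (ae_lebesgue_pt hz) zz => x ? [? ?].
pose chain n x := exists p : nat -> R, [/\ forall k, (k < n)%N -> p k <= p k.+1,
  forall k, (k <= n)%N -> G (p k), p n <= x &
  forall k, (k <= n)%N -> z (p k) = (odd k)%:R].
have [c tc] : exists c, tv z = c%:E.
  by have := tv_ge0 z; move: tz; case: (tv z) => // c _ _; exists c.
have chain_le n x : chain n x -> n%:R <= c.
  move=> [p [pm pG _ pz]].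
  have := variation_lebesgue_pt hz pm (fun k kn => let: And3 a _ _ := pG k kn in a).
  rewrite tc lee_fin (eq_bigr (fun=> 1)); first by rewrite sumr_const card_ord.
  move=> [k kn] _ /=; rewrite !pz ?(ltnW kn)//=.
  by case: (odd k) => /=; rewrite ?subr0 ?sub0r ?normrN normr1.
have chain_mono n x x' : x <= x' -> chain n x -> chain n x'.
  by move=> xx' [p [? ? pn ?]]; exists p; split => //; exact: le_trans xx'.
have chain0 x : chain 0%N x.
  have [t /andP[_ tx] Gt] : exists2 t, Num.min x 0 - 1 < t < Num.min x 0 & G t.
    by apply: ae_exists aeG; rewrite ltrBlDr ltrDl.
  exists (fun=> t); split => //.
  - by move: tx; rewrite lt_min => /andP[/ltW].
  - move=> k; rewrite leqn0 => /eqP ->; case: Gt => _ _ -> //.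
    by move: tx; rewrite lt_min => /andP[].
pose N := Num.bound c.
have chainN n x : chain n x -> (n <= N)%N.
  move=> /chain_le nc; rewrite -(ler_nat R) (le_trans nc)// ltW// archi_boundP//.
  by rewrite -lee_fin -tc tv_ge0.
pose P x n := `[< chain n x >].
have exP x : exists n, P x n by exists 0%N; apply/asboolP.
have bP x n : P x n -> (n <= N)%N by move/asboolP/chainN.
pose V x := ex_maxn (exP x) (bP x).
have VP x : chain (V x) x by rewrite /V; case: ex_maxnP => n /asboolP.
have Vmax x n : chain n x -> (n <= V x)%N.
  by rewrite /V; case: ex_maxnP => m _ H /asboolP; exact: H.
have hV : {homo V : x y / x <= y >-> (x <= y)%N}.
  by move=> x x' xx'; apply: Vmax; exact: chain_mono (VP x).
have VN x : (V x <= N)%N by apply: chainN (VP x).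
have zV x : G x -> z x = (odd (V x))%:R.
  move=> Gx; have [p [pm pG pn pz]] := VP x.
  (* If [z x] had the other parity, [x] could be appended to a longest chain. *)
  apply: contrapT => zx.
  suff /Vmax : chain (V x).+1 x by rewrite ltnn.
  exists (fun k => if (k <= V x)%N then p k else x); split.
  - by move=> k; rewrite ltnS => kV; rewrite kV; case: ltnP => [/pm//|Vk];
      rewrite (_ : k = V x)//; apply/eqP; rewrite eqn_leq kV.
  - by move=> k _; case: ifPn => [/pG//|].
  - by rewrite ltnn.
  - move=> k; rewrite leq_eqVlt ltnS => /predU1P[->|kV]; last by rewrite kV pz.
    rewrite ltnn; case: Gx zx => _ + _; rewrite /=.
    by case: (odd (V x)) => /= -[] -> // /(_ erefl).
(* A chain of positive length passes through a point where [z] is 1, which cannot be negative; this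
   is the lower bound asked by [step_jumps]. *)
have V0 x : (0 < V x)%N -> 0 <= x.
  have [p [pm pG pn pz]] := VP x => V0; rewrite leNgt; apply/negP => x0.
  have p1 : p 1%N <= p (V x) by apply: (homo_leq_seq pm); rewrite V0 leqnn.
  case: (pG 1%N V0) => _ _ H; have := pz 1%N V0; rewrite H /=; last first.
    by rewrite (le_lt_trans p1)// (le_lt_trans pn).
  by move/eqP; rewrite eq_sym oner_eq0.
pose Q m := `[< exists x, V x = m >].
have exQ : exists m, Q m by exists (V 0); apply/asboolP; exists 0.
have bQ m : Q m -> (m <= N)%N by move/asboolP => -[x <-].
have [M /asboolP HM Mmax] := ex_maxnP exQ bQ.
have [|s sV] := step_jumps hV _ V0 HM.
  by move=> x; apply: Mmax; apply/asboolP; exists x.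
have [s' ss' E] := odd_count_sorted s; exists s' => //.
by apply: aeS2 aeG (ae_notin s) => x Gx xs; rewrite E sV// zV.
Qed.

Lemma isolated s (y : R) : exists2 d : R, 0 < d &
  forall t, t \in s -> t != y -> d <= `|t - y|.
Proof.
elim: s => [|a s [d d0 H]]; first by exists 1.
have [->|ay] := eqVneq a y.
  by exists d => // t; rewrite inE => /predU1P[->|/H//]; rewrite eqxx.
exists (Num.min d `|a - y|); first by rewrite lt_min d0 normr_gt0 subr_eq0.
move=> t; rewrite inE ge_min => /predU1P[-> _|ts ty]; first by rewrite lexx orbT.
by rewrite H.
Qed.

Lemma count_le_jump s (y : R) : uniq s -> y \in s ->
  count (<= y) s = (count (< y) s).+1.
Proof.
move=> us ys; have /permP p := perm_to_rem ys; rewrite !p /= lexx ltxx add0n add1n.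
congr (_.+1); apply: eq_in_count => t; rewrite mem_rem_uniq// inE => /andP[/= ty _].
by rewrite lt_neqAle ty.
Qed.

Lemma count_le_nth s k (x : R) : sorted <%R s -> (k <= size s)%N ->
  (forall i, (i < k)%N -> nth 0 s i <= x) ->
  (forall i, (k <= i < size s)%N -> x < nth 0 s i) -> count (<= x) s = k.
Proof.
move=> ss ks Hl Hr; rewrite -(cat_take_drop k s) count_cat.
have -> : count (<= x) (take k s) = k.
  rewrite -[RHS](size_takel ks); apply/eqP; rewrite -all_count.
  by apply/(all_nthP 0) => i; rewrite size_takel// => ik; rewrite /= nth_take// Hl.
rewrite -[RHS]addn0; congr (_ + _)%N; apply/eqP; rewrite -leqn0 leqNgt -has_count.
apply/negP => /(has_nthP 0)[i]; rewrite size_drop ltn_subRL /= nth_drop => iks.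
by rewrite leNgt Hr// leq_addr.
Qed.

(** Within [d] of [y] there is no other edge, so the count grows by exactly one between sample
    points chosen on either side, and its parity changes. *)
Lemma parity_jump z s (y a b c : R) : sorted <%R s ->
  (\forall x \ae mu, z x = (odd (count (<= x) s))%:R) ->
  y \in s -> a < y < b -> ~ z = cst c %[ae mu in `]a, b[%classic].
Proof.
move=> ss zs ys /andP[ay yb] zc; have [d d0 Hd] := isolated s y.
have zcs : \forall x \ae mu, a < x < b -> (odd (count (<= x) s))%:R = c.
  by apply: aeS2 zs zc => x -> H xab; rewrite H//= in_itv.
have left_ : Num.max a (y - d) < y by rewrite gt_max ay ltrBlDr ltrDl.
have right_ : y < Num.min b (y + d) by rewrite lt_min yb ltrDl.
have [x1 /andP[+ x1y] H1] := ae_exists left_ zcs.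
have [x2 /andP[x2y +] H2] := ae_exists right_ zcs.
rewrite gt_max lt_min => /andP[x2b x2d] /andP[x1a x1d].
have us : uniq s by exact: lt_sorted_uniq ss.
have c1 : count (<= x1) s = count (< y) s.
  apply: eq_in_count => t ts; have [->|ty] := eqVneq t y.
    by rewrite /= ltxx leNgt x1y.
  have := Hd t ts ty; rewrite ler_normr => /orP[]h; apply/idP/idP => /= ?; lra.
have c2 : count (<= x2) s = (count (< y) s).+1.
  rewrite -count_le_jump//; apply: eq_in_count => t ts; have [->|ty] := eqVneq t y.
    by rewrite /= lexx ltW.
  have := Hd t ts ty; rewrite ler_normr => /orP[]h; apply/idP/idP => /= ?; lra.
have := H1; rewrite -H2 ?x2b ?(lt_trans ay x2y)// ?x1a ?(lt_trans x1y yb)//.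
rewrite c1 c2 /= => /(_ erefl) /eqP; case: (odd _) => /=.
  by rewrite oner_eq0.
by rewrite eq_sym oner_eq0.
Qed.

(** The interval between consecutive edges is a stripe in the sense of [is_stripe]: a larger one
    would have an edge in its interior, against [parity_jump]. The same lemma excludes edges outside
    [[0, 1]], where [z] is constant. *)
Lemma barcode_min_structure (omega : R) z : 0 < omega -> barcode_min omega z ->
  exists s, [/\ \forall x \ae mu, z x = (odd (count (<= x) s))%:R,
    sorted <%R s, forall y, y \in s -> 0 <= y <= 1 &
    forall k, (k.+1 < size s)%N -> nth 0 s k + omega <= nth 0 s k.+1].
Proof.
move=> o0 [bz zo]; have [s ss zs] := barcode_parity bz.
have [_ _ zout] := bz.
have s01 y : y \in s -> 0 <= y <= 1.
  move=> ys; apply/andP; split; rewrite leNgt; apply/negP => hy.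
    apply: (parity_jump (a := y - 1) (b := 0) (c := 0) ss zs ys).
      by rewrite hy andbT ltrBlDr ltrDl.
    apply: aeS zout => x H; rewrite /= in_itv/= => /andP[_ x0]; apply: H => /=.
    by rewrite in_itv/= leNgt x0.
  apply: (parity_jump (a := 1) (b := y + 1) (c := 0) ss zs ys).
    by rewrite hy/= ltrDl.
  apply: aeS zout => x H; rewrite /= in_itv/= => /andP[x1 _]; apply: H => /=.
  by rewrite in_itv/= [x <= 1]leNgt x1 andbF.
exists s; split => // k ks; have ks' := ltnW ks.
have ys : nth 0 s k \in s by exact: mem_nth.
have ys1 : nth 0 s k.+1 \in s by exact: mem_nth.
have yy : nth 0 s k < nth 0 s k.+1 by rewrite (sorted_ltn_nth lt_trans).
rewrite addrC -lerBrDr; apply: (zo (odd k.+1)); split => //.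
- by case/andP: (s01 _ ys).
- by case/andP: (s01 _ ys1).
- apply: aeS zs => x -> /=; rewrite in_itv/= => /andP[kx xk].
  rewrite (@count_le_nth s k.+1 x)// => [i ik|i /andP[ki is_]].
    rewrite (le_trans _ (ltW kx))// (lt_sorted_leq_nth 0 ss) ?inE//.
    exact: leq_trans ik ks'.
  by rewrite (lt_le_trans xk)// (lt_sorted_leq_nth 0 ss) ?inE.
- move=> a' b' a'0 a'a bb' b'1 zc; split; apply/eqP; rewrite eq_le ?a'a ?bb' ?andbT /=.
    rewrite leNgt; apply/negP => a'lt.
    by apply: (parity_jump ss zs ys _ zc); rewrite a'lt (lt_le_trans yy).
  rewrite leNgt; apply/negP => b'lt.
  by apply: (parity_jump ss zs ys1 _ zc); rewrite b'lt andbT (le_lt_trans a'a).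
Qed.

End barcode_structure.

(** * Bar codes as alternating sums of Heaviside functions *)

Section alternating_sums.
Context {R : realType}.
Local Notation mu := (@lebesgue_measure R).
Implicit Types (u v z f g : R -> R) (s : seq R).

Lemma nth_le_count s k (x : R) : sorted <%R s -> (k < size s)%N ->
  (nth 0 s k <= x) = (k < count (<= x) s)%N.
Proof.
elim: s k => // a s IH k /= ps.
have ss := path_sorted ps.
have xa : x < a -> count (<= x) s = 0%N.
  move=> xa; apply/eqP; rewrite -leqn0 leqNgt -has_count; apply/hasPn => t ts /=.
  by rewrite -ltNge (lt_trans xa)//; move/allP : (order_path_min lt_trans ps); apply.
case: k => [_|k] /=; first by case: leP => [//|/xa ->].
rewrite ltnS => ks; rewrite IH//; case: (leP a x) => [_|/xa ->] //.
Qed.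

Lemma parity_sum s (x : R) : sorted <%R s ->
  (odd (count (<= x) s))%:R = \sum_(k < size s) (-1) ^+ k * (nth 0 s k <= x)%R%:R :> R.
Proof.
move=> ss; rewrite (eq_bigr (fun k : 'I_(size s) => (-1) ^+ k * (k < count (<= x) s)%N%:R)).
  move: (count_size (<= x) s); move: (count _ s) (size s) => m n mn.
  rewrite -(subnKC mn) big_split_ord/= [X in _ + X]big1 => [|k _]; last first.
    by rewrite ltnNge leq_addr mulr0.
  rewrite addr0 (eq_bigr (fun k : 'I_m => (-1) ^+ k)) => [|k _]; last first.
    by rewrite ltn_ord mulr1.
  elim: m {mn} => [|m IH]; first by rewrite big_ord0.
  by rewrite big_ord_recr/= -IH -signr_odd; case: (odd m) => /=; lra.
by move=> k _; rewrite nth_le_count.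
Qed.

Lemma Rintegral_sum n (f : nat -> R -> R) : (forall k, (k < n)%N -> L1 (f k)) ->
  L1 (fun x => \sum_(k < n) f k x) /\
  \int[mu]_x (\sum_(k < n) f k x) = \sum_(k < n) \int[mu]_x f k x.
Proof.
elim: n => [_|n IH H].
  rewrite big_ord0 (_ : (fun _ => _) = cst 0); last by apply/funext => x; rewrite big_ord0.
  by split; [exact: L1_cst0|rewrite /Rintegral integral0].
have [h1 h2] := IH (fun k kn => H k (ltnW kn)).
rewrite (_ : (fun _ => _) = fun x => \sum_(k < n) f k x + f n x); last first.
  by apply/funext => x; rewrite big_ord_recr.
by split; [apply: L1D => //; exact: H|rewrite RintegralD// ?h2 ?big_ord_recr//; exact: H].
Qed.

Lemma bdd_measurable_heaviside (a : R) : bdd_measurable (fun x => (a <= x)%R%:R : R).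
Proof.
split; last by exists 1 => x; case: (a <= x); rewrite ?normr0 ?normr1.
rewrite (_ : (fun _ => _) = \1_`[a, +oo[%classic); first exact: measurable_indic.
by apply/funext => x; rewrite indicE mem_setE in_itv/= andbT.
Qed.

Lemma L1_bdd_support f (B : R) : bdd_measurable f ->
  (forall x, B < `|x| -> f x = 0) -> L1 f.
Proof.
move=> bf fB; rewrite (_ : f = fun x => f x * \1_`[- B, B] x).
  by apply: L1_mul => //; exact: (@integrable_indic_itv R (- B) B true false).
apply/funext => x; rewrite indicE mem_setE in_itv/= -ler_norml.
by case: leP => [|/fB ->]; rewrite ?mulr1 ?mul0r.
Qed.

(** Integrated against the derivative of [phi], each edge contributes plus or minus the value of
    [phi] there, hence at most 1. *)
Lemma tv_parity_le z s : L1 z -> sorted <%R s ->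
  (\forall x \ae mu, z x = (odd (count (<= x) s))%:R) ->
  (tv z <= (size s)%:R%:E)%E.
Proof.
move=> hz ss zs; apply: ge_ereal_sup => _ [phi tphi <-].
have bphi := tv_test_bdd_derive1 tphi.
have [B B0 phiB] := tv_test_support tphi.
have [dphi cphi _ phi1] := tphi.
have hphi : L1 (derive1 phi) by apply: (@L1_bdd_support _ B) => // x /phiB[].
have hk k : L1 (fun x => (-1) ^+ k * ((nth 0 s k <= x)%R%:R * derive1 phi x)).
  by apply: L1Z; apply: L1_mul => //; exact: bdd_measurable_heaviside.
have [h1 h2] := Rintegral_sum (fun k (_ : (k < size s)%N) => hk k).
have E : (fun x => z x * derive1 phi x) = (fun x => \sum_(k < size s)
    (-1) ^+ k * ((nth 0 s k <= x)%R%:R * derive1 phi x)) %[ae mu].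
  apply: aeS zs => x -> _ /=; rewrite parity_sum// mulr_suml.
  by apply: eq_bigr => k _; rewrite mulrA.
have hzphi : L1 (fun x => z x * derive1 phi x).
  rewrite (_ : (fun _ => _) = fun x => derive1 phi x * z x); first exact: L1_mul.
  by apply/funext => x; rewrite mulrC.
rewrite L1_EFin_Rintegral// lee_fin (ae_eq_Rintegral _ _ E); last 2 first.
- exact: L1_measurable.
- exact: L1_measurable.
rewrite h2 -[leRHS]mulr1 mulr_natl -[X in _ *+ X]card_ord -sumr_const.
apply: ler_sum => k _; rewrite RintegralZl//; last first.
  by apply: L1_mul => //; exact: bdd_measurable_heaviside.
set a := nth 0 s k; pose b := Num.max a (B + 1).
have ab : a <= b by rewrite le_max lexx.
have Bb : B < b by rewrite lt_max; apply/orP; right; lra.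
have -> : \int[mu]_x ((a <= x)%R%:R * derive1 phi x) = - phi a.
  have dF (x : R) : is_derive x (1 : R) phi (derive1 phi x).
    by apply: DeriveDef; [exact: dphi|rewrite derive1E].
  have phib : phi b = 0.
    by apply: (phiB b _).1; rewrite ger0_norm// ltW// (lt_trans B0).
  have := Rintegral_C1 dF cphi ab; rewrite phib sub0r => <-.
  rewrite [RHS]Rintegral_mkcond; apply: eq_Rintegral => x _.
  rewrite patchE mem_setE in_itv/=; case: (leP a x) => ax; rewrite ?mul0r// mul1r.
  case: (leP x b) => // bx; apply: (phiB x _).2.
  by rewrite ger0_norm ?(lt_trans Bb)// ltW// (lt_trans B0)// (lt_trans Bb).
by rewrite (le_trans (ler_norm _))// normrM normrX normrN1 expr1n mul1r normrN.
Qed.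

Lemma convol_hat_parity (h x : R) z s : 0 < h -> L1 z -> sorted <%R s ->
  (\forall x \ae mu, z x = (odd (count (<= x) s))%:R) ->
  convol (hat h) z x = \sum_(k < size s) (-1) ^+ k * hat_cdf h (x - nth 0 s k).
Proof.
move=> h0 hz ss zs; have [hh bh _] := even_kernel_hat h0.
have hk k : L1 (fun y => (-1) ^+ k * (hat h (x - y) * (nth 0 s k <= y)%R%:R)).
  by apply: L1Z; apply: convol_integrandC => //; exact: bdd_measurable_heaviside.
have [h1 h2] := Rintegral_sum (fun k (_ : (k < size s)%N) => hk k).
rewrite /convol (@ae_eq_Rintegral _ _ (fun y => \sum_(k < size s)
    (-1) ^+ k * (hat h (x - y) * (nth 0 s k <= y)%R%:R))).
- rewrite h2; apply: eq_bigr => k _; rewrite RintegralZl//.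
    by congr (_ * _); exact: convol_hat_heaviside.
  by apply: convol_integrandC => //; exact: bdd_measurable_heaviside.
- by apply: L1_measurable; exact: convol_integrand.
- exact: L1_measurable.
- apply: aeS zs => y -> _ /=; rewrite parity_sum// mulr_sumr.
  by apply: eq_bigr => k _; rewrite mulrCA.
Qed.

End alternating_sums.

(** * The variational inequality at z *)

Section smoothing_defect.
Context {R : realType}.
Local Notation mu := (@lebesgue_measure R).
Implicit Types (u v z f g : R -> R) (s : seq R).

Lemma L1_shift (a : R) u : L1 u -> L1 (fun x => u (x - a)).
Proof.
move=> /(L1_reflect 0) /(L1_reflect a); congr L1; apply/funext => x.
by rewrite sub0r opprB.
Qed.

(** The integral is added to its image under the reflection of [t] into [2 * a - t], which changes
    the sign of the factor [g (t - a)]. *)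
Lemma convol_hat_odd (h a x : R) g : 0 < h -> L1 g ->
  (forall t, g (- t) = - g t) ->
  2 * convol (hat h) (fun t => g (t - a)) x =
  \int[mu]_t ((hat h (x - t) - hat h (x - 2 * a + t)) * g (t - a)).
Proof.
move=> h0 hg oddg; have [hh bh _] := even_kernel_hat h0.
have ga := L1_shift a hg.
have i1 := convol_integrand x bh ga.
have i2 := L1_reflect (2 * a) i1.
have i2E : (fun t => hat h (x - (2 * a - t)) * g (2 * a - t - a)) =
    fun t => - 1 * (hat h (x - 2 * a + t) * g (t - a)).
  apply/funext => t; rewrite mulN1r -mulrN -oddg; congr (hat h _ * g _); lra.
rewrite mulrC mulr2n mulrDr mulr1 {2}/convol.
rewrite -(Rintegral_reflect (2 * a) (L1_measurable i1)) -RintegralD//.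
apply: eq_Rintegral => t _; have /= := congr1 (fun F => F t) i2E => ->.
by rewrite mulN1r mulrBl.
Qed.

(** If [x] and [t] lie on the same side of [a], then [x] is closer to [t] than to its mirror image
    [2 * a - t]; the hat being even and decreasing away from 0, this gives the sign of the
    difference of hats in [convol_hat_odd]. *)
Lemma convol_hat_odd_sign (h a x : R) g : 0 < h -> L1 g ->
  (forall t, g (- t) = - g t) -> (forall t, 0 <= t -> g t <= 0) ->
  (a <= x -> convol (hat h) (fun t => g (t - a)) x <= 0) /\
  (x <= a -> 0 <= convol (hat h) (fun t => g (t - a)) x).
Proof.
move=> h0 hg oddg g0; have E := convol_hat_odd a x h0 hg oddg.
have g0' t : t <= 0 -> 0 <= g t.
  by move=> t0; rewrite -[t]opprK oddg oppr_ge0 g0// oppr_ge0.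
have key t : (a <= x -> (hat h (x - t) - hat h (x - 2 * a + t)) * g (t - a) <= 0) /\
    (x <= a -> 0 <= (hat h (x - t) - hat h (x - 2 * a + t)) * g (t - a)).
  have [ta|ta] := leP a t.
    have gt : g (t - a) <= 0 by rewrite g0// subr_ge0.
    split=> xa.
      rewrite mulr_ge0_le0// subr_ge0 hat_mono// ler_norml; apply/andP.
      by rewrite ger0_norm; [split; lra|lra].
    rewrite mulr_le0// subr_le0 hat_mono// ler_norml; apply/andP.
    by rewrite ler0_norm; [split; lra|lra].
  have gt : 0 <= g (t - a) by rewrite g0' // subr_le0 ltW.
  split=> xa.
    rewrite mulr_le0_ge0// subr_le0 hat_mono// ler_norml; apply/andP.
    by rewrite ger0_norm; [split; lra|lra].
  rewrite mulr_ge0// subr_ge0 hat_mono// ler_norml; apply/andP.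
  by rewrite ler0_norm; [split; lra|lra].
split=> xa.
  rewrite -(@pmulr_rle0 _ 2)// E -oppr_ge0 -[X in - X]mul1r -mulNr -RintegralZl//.
    by apply: Rintegral_ge0 => t _; rewrite mulN1r oppr_ge0; apply: (key t).1.
  have [hh bh eh] := even_kernel_hat h0.
  apply: L1_mul; last exact: L1_shift.
  apply: bdd_measurableB; first exact: bdd_measurable_reflect.
  have := bdd_measurable_reflect (2 * a - x) bh; congr bdd_measurable.
  by apply/funext => t; rewrite -eh; congr (hat h _); lra.
by rewrite -(@pmulr_rge0 _ 2)// E; apply: Rintegral_ge0 => t _; apply: (key t).2.
Qed.

Lemma hat_cdf_bdd_measurable (h : R) : 0 < h -> bdd_measurable (hat_cdf h).
Proof.
move=> h0; split.
  apply: nondecreasing_measurable => //= x y; exact: hat_cdf_mono.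
by exists 1 => x; rewrite ger0_norm ?hat_cdf_ge0// hat_cdf_le1.
Qed.

(** The contribution to [D] of a single upward edge at 0. *)
Definition cdf_diff (sigma rho t : R) := hat_cdf rho t - hat_cdf sigma t.

Lemma cdf_diffN (sigma rho t : R) : 0 < sigma -> 0 < rho ->
  cdf_diff sigma rho (- t) = - cdf_diff sigma rho t.
Proof. by move=> s0 r0; rewrite /cdf_diff !hat_cdfN//; lra. Qed.

Lemma cdf_diff_le0 (sigma rho t : R) : 0 < sigma -> sigma <= rho -> 0 <= t ->
  cdf_diff sigma rho t <= 0.
Proof. by move=> s0 sr t0; rewrite subr_le0 hat_cdf_le_width. Qed.

Lemma cdf_diff_out (sigma rho t : R) : 0 < sigma -> sigma <= rho -> rho <= `|t| ->
  cdf_diff sigma rho t = 0.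
Proof.
move=> s0 sr; have r0 := lt_le_trans s0 sr; rewrite /cdf_diff ler_normr => /orP[] rt.
  by rewrite !hat_cdf_right ?subrr// (le_trans sr).
by rewrite !hat_cdf_left ?subrr//; lra.
Qed.

Lemma bdd_cdf_diff (sigma rho : R) : 0 < sigma -> sigma <= rho ->
  bdd_measurable (cdf_diff sigma rho).
Proof.
move=> s0 sr; have r0 := lt_le_trans s0 sr.
by apply: bdd_measurableB; exact: hat_cdf_bdd_measurable.
Qed.

Lemma L1_cdf_diff (sigma rho : R) : 0 < sigma -> sigma <= rho ->
  L1 (cdf_diff sigma rho).
Proof.
move=> s0 sr; apply: (@L1_bdd_support _ _ rho); first exact: bdd_cdf_diff.
by move=> x /ltW; exact: cdf_diff_out.
Qed.

(** An edge acts only within [2 * rho], a radius [rho] coming from the hat and another from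
    [cdf_diff]. So only the last edge up to [x] and the first one after it can contribute. They have
    opposite signs in the sum and lie on opposite sides of [x], so their contributions agree in
    sign. *)
Lemma defect_sign (sigma rho : R) s (x : R) : 0 < sigma -> sigma <= rho ->
  sorted <%R s ->
  (forall k, (k.+1 < size s)%N -> nth 0 s k + 2 * rho <= nth 0 s k.+1) ->
  0 <= (-1) ^+ count (<= x) s * \sum_(k < size s) (-1) ^+ k *
    convol (hat rho) (fun t => cdf_diff sigma rho (t - nth 0 s k)) x.
Proof.
move=> s0 sr ss gap; have r0 := lt_le_trans s0 sr.
have sgn k := @convol_hat_odd_sign rho (nth 0 s k) x (cdf_diff sigma rho) r0
  (L1_cdf_diff s0 sr) (fun t => cdf_diffN t s0 r0) (fun t => cdf_diff_le0 s0 sr).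
have far k : 2 * rho <= `|x - nth 0 s k| ->
    convol (hat rho) (fun t => cdf_diff sigma rho (t - nth 0 s k)) x = 0.
  move=> xk; rewrite /convol (@eq_Rintegral _ _ _ _ _ (cst 0)) => [|t _].
    by rewrite /Rintegral integral0.
  have [tk|tk] := leP rho `|t - nth 0 s k|; first by rewrite cdf_diff_out// mulr0.
  rewrite hat_out ?mul0r//; have := ler_normD (x - t) (t - nth 0 s k).
  by rewrite subrKA; lra.
set m := count _ s.
rewrite mulr_sumr; apply: sumr_ge0 => -[k ks] _ /=.
have xk := nth_le_count x ss ks.
have [km|mk|km] := ltngtP k m.
- have {}xk : nth 0 s k <= x by rewrite xk km.
  have [km1|km1] := ltnP k.+1 m; last first.
    have -> : m = k.+1 by apply/eqP; rewrite eqn_leq km1.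
    by rewrite mulrA exprS mulN1r mulNr -expr2 sqrr_sign mulN1r oppr_ge0 (sgn k).1.
  have ks1 : (k.+1 < size s)%N by rewrite (leq_trans km1)// count_size.
  rewrite far ?mulr0//; have := gap k ks1; have := nth_le_count x ss ks1.
  by rewrite km1 => xk1 ?; rewrite ger0_norm; lra.
- have k0 : (0 < k)%N by rewrite (leq_trans _ mk).
  have ks1 : (k.-1 < size s)%N by rewrite (leq_ltn_trans _ ks)// leq_pred.
  have := nth_le_count x ss ks1; rewrite -/m ltnNge -ltnS prednK// mk /= => /negbT.
  rewrite -ltNge => xk1.
  rewrite far ?mulr0//; have := gap k.-1; rewrite prednK// => /(_ ks) ?.
  by rewrite ler0_norm; lra.
- rewrite -km mulrA -expr2 sqrr_sign mul1r (sgn k).2//.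
  by move: xk; rewrite -/m -km ltnn => /negbT; rewrite -ltNge => /ltW.
Qed.

End smoothing_defect.

Section fidelity_gap.
Context {R : realType}.
Local Notation mu := (@lebesgue_measure R).
Implicit Types (u v w z f g : R -> R) (s : seq R).

Lemma L1_mulC u g : L1 u -> bdd_measurable g -> L1 (fun x => u x * g x).
Proof.
move=> hu bg; have := L1_mul bg hu; congr L1; by apply/funext => x; rewrite mulrC.
Qed.

Lemma convol_defect (sigma rho x : R) s : 0 < sigma -> sigma <= rho ->
  convol (hat rho) (fun t => \sum_(k < size s) (-1) ^+ k *
    cdf_diff sigma rho (t - nth 0 s k)) x =
  \sum_(k < size s) (-1) ^+ k *
    convol (hat rho) (fun t => cdf_diff sigma rho (t - nth 0 s k)) x.
Proof.
move=> s0 sr; have r0 := lt_le_trans s0 sr.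
have [hh bh _] := even_kernel_hat r0.
have hk k : L1 (fun y => (-1) ^+ k * (hat rho (x - y) * cdf_diff sigma rho (y - nth 0 s k))).
  by apply: L1Z; apply: convol_integrand => //; apply: L1_shift; exact: L1_cdf_diff.
have [_ h2] := Rintegral_sum (fun k (_ : (k < size s)%N) => hk k).
rewrite /convol; transitivity (\int[mu]_y \sum_(k < size s)
    (-1) ^+ k * (hat rho (x - y) * cdf_diff sigma rho (y - nth 0 s k))).
  by apply: eq_Rintegral => y _; rewrite mulr_sumr; apply: eq_bigr => k _; rewrite mulrCA.
rewrite h2; apply: eq_bigr => k _; rewrite RintegralZl//.
by apply: convol_integrand => //; apply: L1_shift; exact: L1_cdf_diff.
Qed.

(* [hat rho * defect] is nonpositive on the bars of [z] and nonnegative on its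
   white spaces, so that [z] satisfies the variational inequality of the convex
   problem obtained by relaxing the values to [0, 1]. *)
Lemma fidelity_gap (sigma rho : R) s z u : 0 < sigma -> sigma <= rho ->
  L1 z -> L1 u -> sorted <%R s ->
  (forall k, (k.+1 < size s)%N -> nth 0 s k + 2 * rho <= nth 0 s k.+1) ->
  (\forall x \ae mu, z x = (odd (count (<= x) s))%:R) ->
  (\forall x \ae mu, u x = 0 \/ u x = 1) ->
  \int[mu]_x ((convol (hat rho) z x - convol (hat sigma) z x) ^+ 2) +
  \int[mu]_x (convol (hat rho) (fun y => u y - z y) x ^+ 2) <=
  \int[mu]_x ((convol (hat rho) u x - convol (hat sigma) z x) ^+ 2).
Proof.
move=> s0 sr hz hu ss gap zs u01; have r0 := lt_le_trans s0 sr.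
have kr := even_kernel_hat r0; have ks := even_kernel_hat s0.
have [_ br _] := kr.
pose w y := u y - z y; have hw : L1 w by exact: L1B.
pose D x := convol (hat rho) z x - convol (hat sigma) z x.
have hD : L1 D by apply: L1B; exact: L1_convol.
have bD : bdd_measurable D by apply: bdd_measurableB; exact: bdd_convol.
have DE : D = fun x => \sum_(k < size s) (-1) ^+ k * cdf_diff sigma rho (x - nth 0 s k).
  apply/funext => x; rewrite /D !(@convol_hat_parity _ _ _ z s)// -sumrB.
  by apply: eq_bigr => k _; rewrite -mulrBr.
rewrite -[X in X + _]/(\int[mu]_x (D x ^+ 2)) -/w.
have hK := L1_convol kr hw; have bK := bdd_convol kr hw.
have hND : L1 (fun x => - D x).
  by have := L1Z (-1) hD; congr L1; apply/funext => x; rewrite mulN1r.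
have E : \int[mu]_x ((convol (hat rho) u x - convol (hat sigma) z x) ^+ 2) =
    \int[mu]_x ((convol (hat rho) w x - - D x) ^+ 2).
  by apply: eq_Rintegral => x _; rewrite /w convolB//; congr (_ ^+ 2); rewrite /D; lra.
rewrite E (Rintegral_sqrB hK bK hND (bdd_measurableN bD)).
have -> : \int[mu]_x ((- D x) ^+ 2) = \int[mu]_x (D x ^+ 2).
  by apply: eq_Rintegral => x _; rewrite sqrrN.
have -> : \int[mu]_x (convol (hat rho) w x * - D x) =
    - \int[mu]_x (w x * convol (hat rho) D x).
  rewrite -convol_adjoint// -mulN1r -RintegralZl//; last exact: L1_mul.
  by apply: eq_Rintegral => x _; rewrite mulrN mulN1r.
(* What remains is that the cross term is nonnegative. It is so pointwise, since [w <= 0] on bars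
   and [w >= 0] on white spaces. *)
rewrite mulrN opprK addrAC [leLHS]addrC lerDl pmulr_rge0//.
have <- : \int[mu]_x (cst 0 x : R) = 0 by rewrite /Rintegral integral0.
apply: ae_le_Rintegral; first exact: L1_cst0.
  by apply: L1_mulC => //; exact: bdd_convol.
apply: aeS2 zs u01 => x zx ux; rewrite /w zx DE convol_defect//.
have := defect_sign x s0 sr ss gap; rewrite -signr_odd.
set G := \sum_(k < _) _; rewrite /cst.
by case: (odd _); case: ux => ->; rewrite /= ?expr0 ?expr1; nra.
Qed.


End fidelity_gap.

(** * Missed stripes *)

Section missed_stripes.
Context {R : realType}.
Local Notation mu := (@lebesgue_measure R).
Implicit Types (u v w z f g : R -> R) (s : seq R).

Lemma is_derive_max_pow n (x : R) :
  is_derive x (1 : R) (fun t => Num.max 0 t ^+ n.+2) (n.+2%:R * Num.max 0 x ^+ n.+1).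
Proof.
elim: n => [|n IH].
  have := C11_is_derive x (C11Z 2 (@C11_half_sqr_pos R)).
  rewrite expr1; congr is_derive; apply/funext => t; lra.
have := is_deriveM (is_derive_id x (1 : R)) IH.
rewrite (_ : id * _ = fun t => Num.max 0 t ^+ n.+3); last first.
  apply/funext => t; rewrite /GRing.mul/= [RHS]exprS.
  by case: (leP 0 t) => // _; rewrite !expr0n/= !mulr0.
move/is_derive_eq; apply; rewrite /GRing.scale/= mulr1.
case: (leP 0 x) => _; last by rewrite !expr0n/= !mulr0 addr0.
by rewrite mulrCA -exprS -[X in _ + X]mul1r -mulrDl natr1.
Qed.

(* [q] is the square of the bound [1 - t1^2 - t2^2 = 2 (hat rho * \1_[a, b]) - 1]
   of [|hat rho * w|], without its cross term [2 t1^2 t2^2]. *)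
Lemma missed_stripe_profile (rho a b : R) : 0 < rho -> 2 * rho <= b - a ->
  let t1 (x : R) : R := Num.max 0 (1 - (x - a) / rho) in
  let t2 (x : R) : R := Num.max 0 (1 - (b - x) / rho) in
  let q (x : R) : R := 1 - (2 * t1 x ^+ 2 - t1 x ^+ 4) - (2 * t2 x ^+ 2 - t2 x ^+ 4) in
  continuous q /\ \int[mu]_(x in `[a, b]) q x = b - a - 14 / 15 * rho.
Proof.
move=> r0 ab t1 t2 q.
(* [K 1 = 2/3 - 1/5 = 7/15] is the loss at one end of the stripe, in units of [rho]; the two ends
   give 14/15. *)
pose K (t : R) : R := 2 / 3 * Num.max 0 t ^+ 3 - 1 / 5 * Num.max 0 t ^+ 5.
pose k (t : R) : R := 2 * Num.max 0 t ^+ 2 - Num.max 0 t ^+ 4.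
have dK (t : R) : is_derive t (1 : R) K (k t).
  have H := is_deriveB (is_deriveZ (2 / 3) (is_derive_max_pow 1 t))
    (is_deriveZ (1 / 5) (is_derive_max_pow 3 t)).
  apply: (is_derive_eq (df := _) H); rewrite /GRing.scale/= /k; lra.
have ck : continuous k.
  move=> t; have cm : {for t, continuous (fun t : R => Num.max 0 t)}.
    exact: (C11_continuous (@C11_half_sqr_pos R)).
  apply: cvgB; last exact: (cvg_comp _ _ cm (@exprn_continuous _ 4 _)).
  by apply: cvgM; [exact: cvg_cst|exact: (cvg_comp _ _ cm (@exprn_continuous _ 2 _))].
have d1 (x : R) : is_derive x (1 : R) (fun x => 1 - (x - a) / rho) (- rho^-1).
  have := is_deriveB (is_derive_cst (1 + a / rho) x (1 : R))
    (is_deriveZ rho^-1 (is_derive_id x (1 : R))).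
  rewrite sub0r /GRing.scale/= mulr1; congr is_derive.
  by apply/funext => t; transitivity ((1 + a / rho) - rho^-1 * t); [by []|lra].
have d2 (x : R) : is_derive x (1 : R) (fun x => 1 - (b - x) / rho) (rho^-1).
  have := is_deriveD (is_derive_cst (1 - b / rho) x (1 : R))
    (is_deriveZ rho^-1 (is_derive_id x (1 : R))).
  rewrite add0r /GRing.scale/= mulr1; congr is_derive.
  by apply/funext => t; transitivity ((1 - b / rho) + rho^-1 * t); [by []|lra].
have cq : continuous q.
  move=> x; have c1 := is_derive_continuous (d1 x).
  have c2 := is_derive_continuous (d2 x).
  apply: cvgB; last exact: (cvg_comp _ _ c2 (ck _)).
  by apply: cvgB; [exact: cvg_cst|exact: (cvg_comp _ _ c1 (ck _))].
split => //.
pose F x := x + rho * K (1 - (x - a) / rho) - rho * K (1 - (b - x) / rho).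
have dF (x : R) : is_derive x (1 : R) F (q x).
  have H1 := is_deriveZ rho
    (@is_derive1_comp _ K (fun x => 1 - (x - a) / rho) x _ _ (dK _) (d1 x)).
  have H2 := is_deriveZ rho
    (@is_derive1_comp _ K (fun x => 1 - (b - x) / rho) x _ _ (dK _) (d2 x)).
  have := is_deriveB (is_deriveD (is_derive_id x (1 : R)) H1) H2.
  have rhoK (c : R) : rho * (c / rho) = c by rewrite mulrC mulfVK// gt_eqF.
  by move/is_derive_eq; apply; rewrite /GRing.scale/= !mulrN !rhoK.
have ab0 : a <= b by lra.
rewrite (Rintegral_C1 dF cq ab0) /F !subrr !mul0r !subr0.
have far : 1 - (b - a) / rho <= 0 by rewrite subr_le0 ler_pdivlMr// mul1r; lra.
rewrite /K (max_r (ler01 : 0 <= 1 :> R)) max_l// !expr0n !expr1n /=; lra.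
Qed.

Lemma missed_stripe (rho a b e : R) w : 0 < rho -> 2 * rho <= b - a -> L1 w ->
  e * e = 1 -> (\forall x \ae mu, `|w x| <= 1) ->
  (\forall x \ae mu, a < x < b -> e * w x = 1) ->
  b - a - 14 / 15 * rho <= \int[mu]_(x in `[a, b]) (convol (hat rho) w x ^+ 2).
Proof.
move=> r0 ab hw ee w1 wab; have kr := even_kernel_hat r0; have [hr br _] := kr.
have [cq <-] := missed_stripe_profile r0 ab.
have ab0 : a <= b by lra.
(* Almost everywhere [e * w] is at least [2 * \1_[a, b] - 1]: it is 1 between [a] and [b] and at
   least -1 elsewhere. Convolution with the hat, of mass 1, preserves the inequality. *)
have low x : 2 * (hat_cdf rho (x - a) - hat_cdf rho (x - b)) - 1 <= e * convol (hat rho) w x.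
  rewrite -convol_hat_itv// -[X in _ - X <= _](Rintegral_hat x r0) /convol.
  have hI : L1 (\1_`[a, b] : R -> R) by exact: (@integrable_indic_itv R a b true false).
  have i1 := convol_integrand x br hI; have i2 := convol_integrand x br hw.
  have i3 := L1_reflect x hr; have i4 := L1Z 2 i1.
  rewrite -RintegralZl// -RintegralZl// -RintegralB//.
  apply: ae_le_Rintegral; [exact: L1B|exact: L1Z|].
  apply: aeS2 (ae_notin [:: a; b]) (aeS2 (fun x h1 h2 => conj h1 h2) w1 wab) => y.
  rewrite !inE negb_or => /andP[ya yb] [w1y waby].
  have := hat_ge0 (x - y) r0; rewrite mulrCA -[X in _ - X]mulr1 indicE mem_setE in_itv/=.
  have ew : -1 <= e * w y.
    have : `|e * w y| <= 1.
      by rewrite normrM (_ : `|e| = 1) ?mul1r//; apply/eqP;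
        rewrite -sqrp_eq1// real_normK ?num_real// expr2 ee.
    by rewrite ler_norml => /andP[].
  case: (leP a y) => [ay|_]; last by rewrite /=; nra.
  case: (leP y b) => [yb'|_]; last by rewrite /=; nra.
  by rewrite /= (mulrCA e) waby ?lt_neqAle 1?eq_sym ?ya ?ay ?yb ?yb'// => ?; nra.
have iK : L1 (fun x => convol (hat rho) w x ^+ 2).
  by apply: L1_sqr; [exact: L1_convol|exact: bdd_convol].
apply: le_Rintegral => //.
- apply: continuous_compact_integrable; first exact: segment_compact.
  exact: continuous_subspaceT.
- exact: integrableS iK.
move=> x /=; rewrite in_itv/= => /andP[ax xb].
have := low x.
have -> : hat_cdf rho (x - b) = 1 - hat_cdf rho (b - x) by rewrite -hat_cdfN// opprB.
rewrite !hat_cdf_tail ?subr_ge0//.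
have -> : convol (hat rho) w x ^+ 2 = (e * convol (hat rho) w x) ^+ 2.
  by rewrite exprMn [e ^+ 2]expr2 ee mul1r.
set t1 := Num.max 0 (1 - (x - a) / rho); set t2 := Num.max 0 (1 - (b - x) / rho).
move: (e * _) => c lowc.
have t10 : 0 <= t1 by rewrite le_max lexx.
have t20 : 0 <= t2 by rewrite le_max lexx.
have t11 : t1 <= 1 by rewrite ge_max ler01 gerBl divr_ge0 ?subr_ge0// ltW.
have t21 : t2 <= 1 by rewrite ge_max ler01 gerBl divr_ge0 ?subr_ge0// ltW.
(* The stripe has length at least [2 * rho], so its two boundary layers do not overlap. Hence the
   lower bound [d] is nonnegative and may be squared. *)
have t12 : t1 = 0 \/ t2 = 0.
  have [xa|xa] := leP rho (x - a).
    by left; rewrite /t1 max_l// subr_le0 ler_pdivlMr// mul1r.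
  by right; rewrite /t2 max_l// subr_le0 ler_pdivlMr// mul1r; lra.
pose d := 1 - t1 ^+ 2 - t2 ^+ 2.
have d0 : 0 <= d.
  by rewrite /d; case: t12 => ->; rewrite expr0n/=; nra.
have dc : d <= c by rewrite /d; lra.
apply: (@le_trans _ _ (d ^+ 2)); last by rewrite ler_sqr ?nnegrE// (le_trans d0).
rewrite /d; have := sqr_ge0 (t1 * t2); lra.
Qed.

End missed_stripes.

(** * Integrals over successive stripes, and injectivity of the blur on bar codes *)

Section jump_count.
Context {R : realType}.
Local Notation mu := (@lebesgue_measure R).
Implicit Types (u v w z f g : R -> R) (s : seq R).

Lemma Rintegral_consecutive f (p : nat -> R) n : L1 f -> (forall x, 0 <= f x) ->
  (forall k, (k < n)%N -> p k <= p k.+1) ->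
  \sum_(k < n) \int[mu]_(x in `[p k, p k.+1]) f x <= \int[mu]_x f x.
Proof.
move=> hf f0 hp.
have hfi (i : interval R) : mu.-integrable [set` i] (EFin \o f).
  by apply: integrableS hf.
have -> : \sum_(k < n) \int[mu]_(x in `[p k, p k.+1]) f x = \int[mu]_(x in `[p 0%N, p n]) f x.
  elim: n hp => [_|n IH hp]; first by rewrite big_ord0 set_itv1 Rintegral_set1.
  have hp' k : (k < n)%N -> p k <= p k.+1 by move=> kn; exact/hp/ltnW.
  have p0n : p 0%N <= p n by apply: (homo_leq_seq hp'); rewrite leqnn.
  have := @Rintegral_itvB _ f (BLeft (p 0%N)) (BRight (p n.+1)) (p n) (hfi _).
  rewrite !bnd_simp => /(_ p0n (hp n (ltnSn n))).
  rewrite big_ord_recr/= (IH hp') Rintegral_itv_obnd_cbnd// => <-.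
  by rewrite addrC subrK.
rewrite Rintegral_mkcond; apply: le_Rintegral => //.
  by rewrite -restrict_EFin; apply/integrable_restrict => //; rewrite setTI.
by move=> x _; rewrite patchE; case: ifP.
Qed.

(* Once [w = u - z] vanishes to the left of [a], test against [\1_[a - rho, b - rho]],
   where [b] is the next edge of [z]: [hat rho * \1_[a - rho, b - rho]] is positive
   on ]a, b[ and vanishes to the right of [b], and [w] has constant sign on ]a, b[. *)
Lemma hat_convol_inj (rho : R) s z u : 0 < rho -> L1 z -> L1 u ->
  sorted <%R s -> (forall y, y \in s -> 0 <= y <= 1) ->
  (\forall x \ae mu, z x = (odd (count (<= x) s))%:R) ->
  (\forall x \ae mu, u x = 0 \/ u x = 1) ->
  (\forall x \ae mu, x < 0 \/ 1 < x -> u x = 0 /\ z x = 0) ->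
  (\forall x \ae mu, convol (hat rho) (fun y => u y - z y) x = 0) ->
  u = z %[ae mu].
Proof.
move=> r0 hz hu ss s01 zs u01 out Kw0; have kr := even_kernel_hat r0.
have [_ br _] := kr.
pose w y := u y - z y; have hw : L1 w by exact: L1B.
(* The edges of [z] framed by -1 and 2, so that the outer white spaces are treated like stripes.
   With this shift of index, exactly [k] edges precede a point between [Y k] and [Y k.+1]. *)
pose Y k := if k is k'.+1 then (if (k' < size s)%N then nth 0 s k' else 2) else -1 : R.
have Ys k : (k < size s)%N -> 0 <= nth 0 s k <= 1.
  by move=> ks; apply: s01; exact: mem_nth.
have Ymono k : (k <= size s)%N -> Y k < Y k.+1.
  case: k => [|k] ks /=.
    by case: ltnP => [/Ys/andP[]|_]; lra.
  rewrite ks; case: ltnP => [ks1|_]; first by rewrite (sorted_ltn_nth lt_trans).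
  by have /andP[] := Ys k ks; lra.
have cnt k x : (k <= size s)%N -> Y k < x < Y k.+1 -> count (<= x) s = k.
  move=> ks /andP[ax xb]; apply: count_le_nth => // [i ik|i /andP[ki is_]].
    case: k ks ax {xb} ik => // k ks /=; rewrite ks => kx ik.
    rewrite (le_trans _ (ltW kx))// (lt_sorted_leq_nth 0 ss) ?inE//.
    exact: leq_trans ik ks.
  have ks' := leq_ltn_trans ki is_.
  move: xb; rewrite /= ks' => xk; rewrite (lt_le_trans xk)//.
  by rewrite (lt_sorted_leq_nth 0 ss) ?inE.
have step k : (k <= size s)%N -> (\forall x \ae mu, x < Y k -> w x = 0) ->
    \forall x \ae mu, x < Y k.+1 -> w x = 0.
  move=> ks IH; have ab := Ymono k ks.
  set a := Y k in IH ab *; set b := Y k.+1 in ab *.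
  pose v := \1_`[a - rho, b - rho] : R -> R.
  have bv : bdd_measurable v.
    split; first by apply: measurable_indic; exact: measurable_itv.
    by exists 1 => x; rewrite /v indicE; case: (_ \in _); rewrite ?normr1 ?normr0.
  have vE x : convol (hat rho) v x = hat_cdf rho (x - a + rho) - hat_cdf rho (x - b + rho).
    by rewrite /v convol_hat_itv//; [congr (hat_cdf _ _ - hat_cdf _ _); lra|lra].
  have bKv : bdd_measurable (convol (hat rho) v).
    apply: bdd_convol => //; exact: (@integrable_indic_itv R (a - rho) (b - rho) true false).
  have I0 : \int[mu]_x (w x * convol (hat rho) v x) = 0.
    rewrite -convol_adjoint// (@ae_eq_Rintegral _ _ (cst 0)).
    - by rewrite /Rintegral integral0.
    - apply: measurable_funM; last by case: bv.
      by apply: L1_measurable; exact: L1_convol.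
    - exact: measurable_cst.
    - by apply: aeS Kw0 => x; rewrite -/w => -> _; rewrite mul0r.
  have hwv := L1_mulC hw bKv.
  (* The integrand has zero integral and is nonnegative: it vanishes before [a] by induction and
     after [b] by the choice of [v], and in between [w] has the sign of [(-1) ^+ k]. *)
  have ewv : \forall x \ae mu, (-1) ^+ k * (w x * convol (hat rho) v x) = 0.
    apply: Rintegral_ge0_eq0; first exact: L1Z.
      apply: aeS2 (ae_notin [:: a; b]) (aeS2 (fun x h1 h2 => conj h1 h2) IH
        (aeS2 (fun x h1 h2 => conj h1 h2) u01 zs)) => x.
      rewrite !inE negb_or => /andP[xa xb] [IHx [ux zx]].
      case: (ltP x a) => [/IHx ->|ax]; first by rewrite mul0r mulr0.
      have [xb'|bx] := ltP x b; last first.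
        by rewrite vE !hat_cdf_right//; [rewrite subrr !mulr0|lra|lra].
      have K0 : 0 <= convol (hat rho) v x.
        by rewrite vE subr_ge0 hat_cdf_mono//; lra.
      have cx : count (<= x) s = k by apply: cnt => //; rewrite lt_neqAle eq_sym xa ax.
      rewrite mulrA mulr_ge0// /w zx cx -signr_odd.
      by case: (odd k); case: ux => ->; rewrite /= ?expr0 ?expr1; lra.
    by rewrite RintegralZl// I0 mulr0.
  apply: aeS2 (ae_notin [:: a]) (aeS2 (fun x h1 h2 => conj h1 h2) IH ewv) => x.
  rewrite inE => xa [IHx /eqP]; rewrite mulf_eq0 signr_eq0 /= mulf_eq0 => wv xb.
  case: (ltP x a) => [/IHx//|ax]; case/orP: wv => [/eqP//|].
  rewrite vE (@hat_cdf_right _ _ (x - a + rho))//; last lra.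
  have Sx : hat_cdf rho (x - b + rho) < 1 by apply: hat_cdf_lt1 => //; lra.
  by rewrite subr_eq0 gt_eqF.
have all k : (k <= (size s).+1)%N -> \forall x \ae mu, x < Y k -> w x = 0.
  elim: k => [_|k IH ks]; last by apply: step => //; apply: IH; exact: ltnW.
  apply: aeS out => x H x1; rewrite /w.
  by have [-> ->] := H (or_introl (lt_trans x1 (ltrN10 _))); rewrite subrr.
have := all _ (leqnn _); rewrite /= ltnn => wlt2.
apply: aeS2 wlt2 out => x w2 H _; apply/eqP; rewrite -subr_eq0; apply/eqP.
have [/w2//|x2] := ltP x 2.
have [-> ->] := H (or_intror (lt_le_trans (ltr1n R 2) x2)).
by rewrite subrr.
Qed.

End jump_count.

(** * Balance between lost jumps and missed stripes *)

Section deblurring.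
Context {R : realType}.
Local Notation mu := (@lebesgue_measure R).
Implicit Types (u v w z f g : R -> R) (s : seq R).

Lemma barcode_out u : barcode u -> \forall x \ae mu, x < 0 \/ 1 < x -> u x = 0.
Proof.
move=> [_ _ uout]; apply: aeS uout => x H x01; apply: H => /=; rewrite in_itv/=.
by case: x01 => [x0|x1] /andP[h1 h2]; [move: h1|move: h2]; rewrite leNgt ?x0 ?x1.
Qed.

(* Almost everywhere on its [k]-th inner stripe, [z] is [odd k.+1]. *)
Definition missed u s k :=
  \forall x \ae mu, nth 0 s k < x < nth 0 s k.+1 -> u x = (odd k)%:R.

(** Sample [u] at one Lebesgue point in each interval cut out by the edges of [z], where it agrees
    with [z] if the interval is not missed. Two consecutive such samples differ by 1, and a missed
    stripe spoils the two increments next to it, hence the factor 2. *)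
Lemma tv_ge_missed u s : barcode u -> sorted <%R s ->
  (forall y, y \in s -> 0 <= y <= 1) -> ~~ odd (size s) ->
  (((size s)%:R - 2 * \sum_(k < (size s).-1) `[< missed u s k >]%:R)%:E <= tv u)%E.
Proof.
move=> bu ss s01 en; have [[hu tu] u01 _] := bu; set n := size s.
pose G x := [/\ lebesgue_pt u x, u x = 0 \/ u x = 1 & x < 0 \/ 1 < x -> u x = 0].
have aeG : \forall x \ae mu, G x.
  apply: aeS2 (ae_lebesgue_pt hu) (aeS2 (fun x h1 h2 => conj h1 h2) u01 (barcode_out bu)).
  by move=> x ? [].
(* The [k]-th sampled interval ends at edge [k], so it is the inner stripe of index [k.-1]. The
   intervals of index 0 and [n] are the outer spaces, never missed: [u] is 0 there and [n] is
   even. *)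
pose M k := (0 < k < n)%N && `[< missed u s k.-1 >].
have ys k : (k < n)%N -> 0 <= nth 0 s k <= 1 by move=> kn; apply/s01/mem_nth.
have pt k : exists x, (k <= n)%N -> [/\ G x, ((0 < k)%N -> nth 0 s k.-1 < x),
    ((k < n)%N -> x < nth 0 s k) & ~~ M k -> u x = (odd k)%:R].
  have [kn|nk] := leqP k n; last by exists 0.
  have [k0|k0] := posnP k.
    have [x /andP[_ x0] Gx] := ae_exists (ltrN10 R) aeG.
    exists x => _; rewrite k0; split=> // [n0|_].
      by rewrite (lt_le_trans x0)//; case/andP: (ys 0%N n0).
    by case: Gx => _ _ /(_ (or_introl x0)).
  have k1n : (k.-1 < n)%N by rewrite (leq_trans _ kn)// prednK.
  have [nk|kn'] := leqP n k.
    have [x /andP[x1 _] Gx] := ae_exists (ltr1n R 2) aeG.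
    have kE : k = n by apply/eqP; rewrite eqn_leq kn.
    exists x => _; split=> // [_|_].
      by rewrite (le_lt_trans _ x1)//; case/andP: (ys _ k1n).
    by rewrite kE (negbTE en); case: Gx => _ _ /(_ (or_intror x1)).
  have kk : nth 0 s k.-1 < nth 0 s k.
    by rewrite (sorted_ltn_nth lt_trans) ?inE// prednK.
  have [Mk|Mk] := boolP (M k).
    have [x /andP[x1 x2] Gx] := ae_exists kk aeG.
    by exists x.
  (* If no good point of the stripe had the value of [z], then [u] would have the opposite value
     almost everywhere on it, that is, the stripe would be missed. *)
  apply: contrapT => nex; move: Mk; rewrite /M k0 kn' /= => /asboolPn; apply.
  apply: aeS aeG => x Gx; rewrite prednK// => /andP[x1 x2].
  apply: contrapT => ux; apply: nex; exists x => _; split=> // _.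
  rewrite -[k]prednK//= ; case: Gx ux => _ + _.
  by case: (odd k.-1) => /= -[] -> // /(_ erefl).
have [p Hp] := choice pt.
have hp k : (k < n)%N -> p k <= p k.+1.
  move=> kn; have [_ _ H1 _] := Hp k (ltnW kn); have [_ H2 _ _] := Hp k.+1 kn.
  by rewrite ltW// (lt_trans (H1 kn))// H2.
have hL k : (k <= n)%N -> lebesgue_pt u (p k) by move=> /Hp[[]].
apply: le_trans (variation_lebesgue_pt hu hp hL); rewrite lee_fin.
have term k : (k < n)%N -> 1 - (M k)%:R - (M k.+1)%:R <= `|u (p k.+1) - u (p k)|.
  move=> kn; have [_ _ _ H1] := Hp k (ltnW kn); have [_ _ _ H2] := Hp k.+1 kn.
  case: (M k) H1 => H1.
    by case: (M k.+1) H2 => _ /=; rewrite ?subrr ?sub0r ?subr0// (@le_trans _ _ 0)// oppr_le0.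
  case: (M k.+1) H2 => H2 /=; first by rewrite subr0 subrr.
  rewrite H1// H2//= !subr0.
  by case: (odd k) => /=; rewrite ?subr0 ?sub0r ?normrN normr1.
apply: le_trans (ler_sum _ (fun (k : 'I_n) _ => term k (ltn_ord k))).
rewrite !sumrB sumr_const card_ord.
have [n0|n0] := posnP n.
  by rewrite n0 !big_ord0 mulr0 !subr0.
have Mn : M n = false by rewrite /M ltnn andbF.
have [n' nE] : exists n', n = n'.+1 by exists n.-1; rewrite prednK.
have MS k : (k < n')%N -> M k.+1 = `[< missed u s k >].
  by move=> kn; rewrite /M /= nE ltnS kn.
have E1 : \sum_(k < n) (M k.+1)%:R = \sum_(k < n.-1) `[< missed u s k >]%:R :> R.
  by rewrite nE big_ord_recr/= -nE Mn addr0; apply: eq_bigr => k _; rewrite MS.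
have E2 : \sum_(k < n) (M k)%:R = \sum_(k < n.-1) `[< missed u s k >]%:R :> R.
  by rewrite nE big_ord_recl/= add0r; apply: eq_bigr => k _; rewrite MS.
by rewrite E1 E2; lra.
Qed.

Lemma fidelity_ge_missed (omega rho : R) s z u : 0 < rho -> 2 * rho <= omega ->
  L1 z -> L1 u -> sorted <%R s ->
  (forall k, (k.+1 < size s)%N -> nth 0 s k + omega <= nth 0 s k.+1) ->
  (\forall x \ae mu, z x = (odd (count (<= x) s))%:R) ->
  (\forall x \ae mu, u x = 0 \/ u x = 1) ->
  (\sum_(k < (size s).-1) `[< missed u s k >]%:R) * (omega - 14 / 15 * rho) <=
  \int[mu]_x (convol (hat rho) (fun y => u y - z y) x ^+ 2).
Proof.
move=> r0 ro hz hu ss gap zs u01; have kr := even_kernel_hat r0.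
pose w y := u y - z y; have hw : L1 w by exact: L1B.
rewrite -/w.
have hX : L1 (fun x => convol (hat rho) w x ^+ 2).
  by apply: L1_sqr; [exact: L1_convol|exact: bdd_convol].
have kn k : (k < (size s).-1)%N -> (k.+1 < size s)%N.
  by case: (size s).
have mono k : (k < (size s).-1)%N -> nth 0 s k <= nth 0 s k.+1.
  by move=> /kn /gap; lra.
apply: le_trans (Rintegral_consecutive hX (fun x => sqr_ge0 _) mono).
rewrite mulr_suml; apply: ler_sum => -[k /= ks] _; have ks1 := kn k ks.
have [/asboolP mk|_] := boolP `[< _ >]; last first.
  by rewrite mul0r; apply: Rintegral_ge0 => x _; exact: sqr_ge0.
rewrite mul1r; have gk := gap k ks1.
apply: (@le_trans _ _ (nth 0 s k.+1 - nth 0 s k - 14 / 15 * rho)); first lra.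
(* On the missed stripe [w] is the difference of the parities of [k] and [k.+1], which equals this
   sign. *)
apply: (@missed_stripe _ _ _ _ ((-1) ^+ k.+1)) => //; first lra.
- by rewrite -expr2 sqrr_sign.
- apply: aeS2 u01 zs => x ux zx; rewrite /w zx.
  by case: (odd _); case: ux => ->;
    rewrite ?subrr ?subr0 ?sub0r ?normrN ?normr1 ?normr0 ?ler01.
- apply: aeS2 mk zs => x ux zx xk; rewrite /w ux// zx.
  have /andP[kx xk1] := xk.
  have -> : count (<= x) s = k.+1.
    apply: count_le_nth => // [|i ik|i /andP[ki is_]]; first exact: ltnW.
      rewrite (le_trans _ (ltW kx))// (lt_sorted_leq_nth 0 ss) ?inE//; last exact: ltnW.
      by rewrite (leq_ltn_trans _ ks1)// ltnW.
    by rewrite (lt_le_trans xk1)// (lt_sorted_leq_nth 0 ss) ?inE.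
  by rewrite -signr_odd /=; case: (odd k); rewrite /= ?expr0 ?expr1; lra.
Qed.

Lemma barcode_deblurring (omega sigma rho lambda : R) z u :
  0 < omega -> 0 < sigma -> 0 < lambda -> barcode_min omega z ->
  sigma <= rho -> rho <= omega / 2 ->
  2 / lambda + (15 * rho ^+ 2)^-1
    * (- sigma ^+ 3 + 5 * rho * sigma ^+ 2 + 17 * rho ^+ 3) < omega ->
  barcode u ->
  let F := F3 lambda (hat rho) (convol (hat sigma) z) in
  (F z <= F u)%E /\ ((F u <= F z)%E -> u = z %[ae mu]).
Proof.
move=> o0 s0 l0 hz sr ro Hl bu F; have r0 := lt_le_trans s0 sr.
have [s [zs ss s01 gap]] := barcode_min_structure o0 hz.
have bz : barcode z by case: hz.
have [[Lz tvz] _ _] := bz; have [[Lu tvu] u01 _] := bu.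
have ro2 : 2 * rho <= omega by lra.
(* To the right of 1 all edges have been passed and [z] is 0. *)
have en : ~~ odd (size s).
  have [x /andP[x1 _] [zx zx0]] := ae_exists (ltr1n R 2)
    (aeS2 (fun x h1 h2 => conj h1 h2) zs (barcode_out bz)).
  have cx : count (<= x) s = size s.
    apply/eqP; rewrite -all_count; apply/allP => y /s01/andP[_ y1].
    by rewrite /= (le_trans y1)// ltW.
  by move: (zx0 (or_intror x1)); rewrite zx cx; case: (odd _) => // /eqP; rewrite oner_eq0.
have kr := even_kernel_hat r0; have ks := even_kernel_hat s0.
have Lf := L1_convol ks Lz; have bf := bdd_convol ks Lz.
have [tz tzE] : exists t, tv z = t%:E.
  by have := tv_ge0 z; move: tvz; case: (tv z) => // t _ _; exists t.
have [tu tuE] : exists t, tv u = t%:E.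
  by have := tv_ge0 u; move: tvu; case: (tv u) => // t _ _; exists t.
have H1 := tv_parity_le Lz ss zs.
have H2 := tv_ge_missed bu ss s01 en.
have H3 := fidelity_ge_missed r0 ro2 Lz Lu ss gap zs u01.
have gap' k : (k.+1 < size s)%N -> nth 0 s k + 2 * rho <= nth 0 s k.+1.
  by move=> /gap; lra.
have H4 := fidelity_gap s0 sr Lz Lu ss gap' zs u01.
have KX0 : 0 <= \int[mu]_x (convol (hat rho) (fun y => u y - z y) x ^+ 2).
  by apply: Rintegral_ge0 => x _; exact: sqr_ge0.
have Xae : \int[mu]_x (convol (hat rho) (fun y => u y - z y) x ^+ 2) <= 0 -> u = z %[ae mu].
  have Lw := L1B Lu Lz.
  move=> X0; apply: (hat_convol_inj r0 Lz Lu ss s01 zs u01).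
    apply: aeS2 (barcode_out bu) (barcode_out bz) => x h1 h2 x01.
    by split; [exact: h1|exact: h2].
  have := Rintegral_ge0_eq0 (L1_sqr (L1_convol kr Lw) (bdd_convol kr Lw)).
  have nn : \forall x \ae mu, 0 <= convol (hat rho) (fun y => u y - z y) x ^+ 2.
    by apply: aeW => x; exact: sqr_ge0.
  by move=> /(_ nn X0); apply: aeS => x /eqP; rewrite sqrf_eq0 => /eqP.
rewrite /F (F3E _ kr Lf bf Lz) (F3E _ kr Lf bf Lu) tzE tuE -!EFinD !lee_fin.
move: H1 H2 H3 H4 KX0 Xae; rewrite tzE tuE !lee_fin.
set m := \sum_(k < _) _.
have m01 : m = 0 \/ 1 <= m.
  rewrite /m -natr_sum; case: (\sum_(k < _) _)%N => [|k]; first by left.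
  by right; rewrite ler1n.
move: (\int[mu]_x (convol (hat rho) (fun y => u y - z y) x ^+ 2)) => X.
move: (\int[mu]_x ((convol _ z x - _) ^+ 2)) (\int[mu]_x ((convol _ u x - _) ^+ 2)) => Ez Eu.
move=> tzn tun mX EX X0 Xae.
(* From [sigma <= rho], the cube of [sigma] is at most [rho * sigma ^+ 2], so the last factor of the
   hypothesis is at least [17 * rho ^+ 3]. This gives [2 / lambda + 17 / 15 * rho < omega], and
   14/15 is below 17/15. *)
have lc : 2 < lambda * (omega - 14 / 15 * rho).
  rewrite mulrC -ltr_pdivrMr//.
  have : 17 / 15 * rho <= (15 * rho ^+ 2)^-1 *
      (- sigma ^+ 3 + 5 * rho * sigma ^+ 2 + 17 * rho ^+ 3).
    rewrite ler_pdivlMl; last by rewrite mulr_gt0// exprn_gt0.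
    have : sigma ^+ 3 <= rho * sigma ^+ 2 by rewrite exprS ler_wpM2r ?sqr_ge0.
    have : 0 <= rho * sigma ^+ 2 by rewrite mulr_ge0 ?sqr_ge0// ltW.
    lra.
  by lra.
have m0 : 0 <= m by case: m01 => [->|]; lra.
have lX : lambda * (m * (omega - 14 / 15 * rho)) <= lambda * X by rewrite ler_pM2l.
have lm : 2 * m <= lambda * (m * (omega - 14 / 15 * rho)).
  by rewrite mulrCA mulrC ler_wpM2l// ltW.
have lE : lambda * (Ez + X) <= lambda * Eu by rewrite ler_pM2l.
(* Replacing [z] by [u] saves at most [2 * m] in variation and costs at least [lambda * X] in
   fidelity, which is at least [2 * m]. *)
split; first by rewrite mulrDr in lE; lra.
move=> FF; apply: Xae; rewrite -(pmulr_rle0 _ l0).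
(* Without missed stripes nothing is saved, so [lambda * X <= 0]; with at least one, the cost
   strictly exceeds the saving. *)
case: m01 => [m00|m1]; first by rewrite m00 in tun; rewrite mulrDr in lE; lra.
exfalso; have : 2 * m < lambda * (m * (omega - 14 / 15 * rho)).
  by rewrite mulrCA mulrC ltr_pM2l//; lra.
by rewrite mulrDr in lE; lra.
Qed.

End deblurring.

Theorem theorem1p2 (R : realType) (omega sigma rho lambda : R) (z : R -> R)
    (omega_gt0 : 0 < omega) (sigma_gt0 : 0 < sigma) (rho_gt0 : 0 < rho)
    (lambda_gt0 : 0 < lambda) (hz : barcode_min omega z) :
  (forall phi_sigma phi_rho : R -> R,
     kernel_class sigma phi_sigma -> kernel_class rho phi_rho ->
     let f_sigma := convol phi_sigma z in
     is_unique_minimiser (F3 lambda phi_rho f_sigma) BVR (cst 0)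
     <-> (dual_norm (convol phi_rho f_sigma) <= ((2 * lambda)^-1)%:E)%E)
  /\
  (forall i j : bool,
     start_end i j z ->
     sigma <= rho -> rho <= omega / 2 ->
     2 / lambda
       + (15 * rho ^+ 2)^-1
         * (- sigma ^+ 3 + 5 * rho * sigma ^+ 2 + 17 * rho ^+ 3) < omega ->
     let f_sigma := convol (hat sigma) z in
     is_unique_minimiser (F3 lambda (hat rho) f_sigma)
       (barcode `&` start_end i j) z).
Proof.
split=> [phi_s phi_r hs hr f|i j zij sr ro Hl f]; last first.
  have key u := barcode_deblurring omega_gt0 sigma_gt0 lambda_gt0 hz sr ro Hl (u := u).
  split; first split; first by split=> //; case: hz.
    by move=> u [bu _]; exact: (key u bu).1.
  move=> u [[bu _] minu]; apply: (key u bu).2; apply: minu.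
  by split=> //; case: hz.
have [[[hzL _] _ _] _] := hz; have mz := L1_measurable hzL.
(* Both kernels are exchanged for bounded even representatives, which changes neither the
   convolutions nor the energies. *)
have [psi_s ks psE] := kernel_class_even sigma_gt0 hs.
have [psi_r kr prE] := kernel_class_even rho_gt0 hr.
have [hs1 [ms _] _] := ks; have [hr1 [mr _] _] := kr.
have mphis : measurable_fun setT phi_s by apply: L1_measurable; case: hs.
have mphir : measurable_fun setT phi_r by apply: L1_measurable; case: hr.
have fE : f = convol psi_s z by exact: convol_ae_kernel.
have Lf : L1 f by rewrite fE; exact: L1_convol.
have bf : bdd_measurable f by rewrite fE; exact: bdd_convol.
have CE u : L1 u -> convol phi_r u = convol psi_r u.
  by move=> hu; apply: convol_ae_kernel => //; exact: L1_measurable.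
have FE u : BVR u -> F3 lambda phi_r f u = F3 lambda psi_r f u.
  by move=> [hu _]; rewrite /F3 CE.
rewrite CE// -(zero_unique_minimiser lambda_gt0 kr Lf bf).
have FE0 := FE _ BVR_cst0.
split=> -[[_ min0] uniq0].
  split; first by split; [exact: BVR_cst0|move=> v bv; rewrite -FE0 -FE//; exact: min0].
  move=> v [bv minv]; apply: uniq0; split=> // v' bv'; rewrite !FE//; exact: minv.
split; first by split; [exact: BVR_cst0|move=> v bv; rewrite FE0 FE//; exact: min0].
by move=> v [bv minv]; apply: uniq0; split=> // v' bv'; rewrite -!FE//; exact: minv.
Qed.
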